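(* Let $q$ be a power of a prime $p$, $K$ the algebraic closure of $\mathbb{F}_q$, and let $m\geq 2$, $r\geq 2$ be integers with $p\nmid m$. Let $\alpha_1,\dots,\alpha_r\in K$ be pairwise distinct, let $\lambda_1,\dots,\lambda_r$ be integers with $1\leq \lambda_i<m$, put $\lambda_0:=\sum_{i=1}^r\lambda_i$, and assume $\gcd(m,\lambda_0)=1$. Let $\mathcal{X}$ be the curve over $K$ defined by $y^m=\prod_{i=1}^r (x-\alpha_i)^{\lambda_i}$ and let $Q_\infty$ be its only place at infinity. With $\eta_s$ and $\epsilon_k$ as defined in the context, the following statements hold: (i) $F_{H(Q_\infty)}=\epsilon_{r-1}$ if and only if $\eta_s<\lfloor sm/\lambda_0\rfloor$ for each $s\in\{r,\dots,\lambda_0-1\}$ such that $\eta_s+\eta_{r+\lambda_0-1-s}=m-1$. (ii) $F_{H(Q_\infty)}=\max\left\{\epsilon_k : r-1\leq k<\lambda_0,\ \eta_k=\left\lfloor\frac{(k+1-r)m}{\lambda_0}\right\rfloor\right\}$. (iii) If $\gcd(m,\lambda_j)=1$ for each $j=1,\dots,r$, then $m_{H(Q_\infty)}=\min\{m,\ m(r-1)-F_{H(Q_\infty)}\}$. (iv) If $\lambda_j$ divides $m$ for each $j=1,\dots,r$, then $m_{H(Q_\infty)}=\min\left\{m,\ \lambda_0,\ \epsilon_{r-1}-\max_{r\leq k<\lambda_0}\epsilon_k\right\}$, where the last term is omitted if $r=\lambda_0$.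
   Context: $\mathcal{X}$ denotes the nonsingular projective irreducible curve over $K$ with function field $K(\mathcal{X})=K(x,y)$; $Q_\infty$ is the unique place lying over the pole of $x$. $H(Q):=\{s\in\mathbb{N}_0 : (z)_\infty=sQ \text{ for some } z\in K(\mathcal{X})\}$, where $(z)_\infty$ is the pole divisor; the Frobenius number $F_{H(Q)}$ is the largest element of $\mathbb{N}\setminus H(Q)$, and the multiplicity $m_{H(Q)}$ is the smallest nonzero element of $H(Q)$. For $r\leq k\leq\lambda_0-1$, $$\eta_k:=\max\left\{\min_{1\leq i\leq r}\left\lfloor\frac{s_im}{\lambda_i}\right\rfloor : s_1,\dots,s_r\in\mathbb{N},\ \sum_{i=1}^r s_i=k,\ 1\leq s_i\leq\lambda_i\right\};$$ moreover $\eta_s:=0$ for $0\leq s<r$ and $\eta_s:=m-1$ for $s\geq\lambda_0$. For $k\in\mathbb{N}_0$, $\epsilon_k:=mk-\lambda_0(\eta_k+1)$ (an integer, possibly negative). *)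

(* Defs.v *)
From HB Require Import structures.
From mathcomp Require Import all_boot all_order all_algebra all_field.

Set Implicit Arguments.
Unset Strict Implicit.
Unset Printing Implicit Defensive.

Import Order.TTheory GRing.Theory Num.Theory.
Local Open Scope ring_scope.

(* An algebraic function field in one variable over K is represented as a     *)
(* finite extension L of the rational function field K(x); the points of the  *)
(* nonsingular projective curve with function field L are the places of L/K.  *)

Notation ratfun K := {fraction {poly K}}.

Section FunctionField.

Variables (K : fieldType) (L : fieldExtType (ratfun K)).

Definition ff_const (c : K) : L := (tofrac c%:P : ratfun K)%:A.

Definition ff_x : L := (tofrac 'X : ratfun K)%:A.

(* A place is a normalized discrete valuation of L trivial on K. The order of *)
(* 0 (which should be +oo) is set to 0 by convention and is never used.       *)
Record place := Place {
  ord_at :> L -> int;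
  ord_at0 : ord_at 0 = 0;
  ord_atM : forall u v, u != 0 -> v != 0 -> ord_at (u * v) = ord_at u + ord_at v;
  ord_atD : forall u v, u != 0 -> v != 0 -> u + v != 0 ->
    Num.min (ord_at u) (ord_at v) <= ord_at (u + v);
  ord_at_const : forall c : K, c != 0 -> ord_at (ff_const c) = 0;
  ord_at_unif : exists2 t, t != 0 & ord_at t = 1
}.

Definition same_place (P Q : place) : Prop := ord_at P =1 ord_at Q.

(* the coefficient at P of the pole divisor of z != 0 *)
Definition pole_order (z : L) (P : place) : int := Num.max 0 (- ord_at P z).

Definition weierstrass_semigroup (Q : place) (s : nat) : Prop :=
  exists z : L, [/\ z != 0, pole_order z Q = s%:Z
    & forall P : place, ~ same_place P Q -> pole_order z P = 0].

End FunctionField.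

Definition is_frobenius_number (H : nat -> Prop) (F : nat) : Prop :=
  [/\ (0 < F)%N, ~ H F & forall n, (0 < n)%N -> ~ H n -> (n <= F)%N].

Definition is_multiplicity (H : nat -> Prop) (mu : nat) : Prop :=
  [/\ (0 < mu)%N, H mu & forall n, (0 < n)%N -> H n -> (mu <= n)%N].

Section EtaEpsilon.

Variables (m r : nat) (lambda : 'I_r -> nat).

Definition lambda0 : nat := (\sum_(i < r) lambda i)%N.

(* The default value m of the minimum over i is harmless for r > 0, since     *)
(* each quotient is at most m. The entries of s are bounded by their sum k.   *)
Definition kummer_eta (k : nat) : nat :=
  if (k < r)%N then 0%N
  else if (lambda0 <= k)%N then m.-1
  else (\max_(s : {ffun 'I_r -> 'I_k.+1} |
                (\sum_(i < r) s i == k) && [forall i, 0 < s i <= lambda i])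
          \big[minn/m]_(i < r) (s i * m %/ lambda i))%N.

Definition kummer_epsilon (k : nat) : int :=
  (m * k)%N%:Z - (lambda0 * (kummer_eta k).+1)%N%:Z.

End EtaEpsilon.

(* Main.v *)
Require Import Defs.
From HB Require Import structures.
From mathcomp Require Import all_boot all_order all_algebra all_field.
From mathcomp Require Import boolp zify ring.

(** Write [w_j = sum_i (j lambda_i mod m)]. Then [H(Q_infty)] is the union of the
    classes [w_j + m N], [0 <= j < m]: the function
    [x^a y^j / prod_i (x - alpha_i)^floor(j lambda_i / m)] has [Q_infty] as its only
    pole, of order [m a + w_j]. Conversely, let [z = sum_j c_j(x) y^j] be regular
    off [Q_infty]. For each [alpha] the places over [x = alpha] are visible in
    [K((s))] through [x = alpha + s^m], [y = zeta s^mu h(s)] with [zeta^m = 1] and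
    [h] a Hensel root, so averaging over [zeta] shows that every [c_j y^j] is
    regular there; the terms [c_j y^j] have distinct orders at [Q_infty], because
    [gcd(m, lambda_0) = 1], so the pole order of [z] is that of one of them.

    With [C(t) = sum_i ceil(t lambda_i / m)], [eta_k] is adjoint to [C]:
    [t <= eta_k] iff [C(t) <= k], for [t < m]. As [w_(m-t) = m C(t) - t lambda_0],
    the maximum of [epsilon_k] over [k < lambda_0] is [max_j w_j - m], the Frobenius
    number. The four statements then follow from [C(m-t) + C(t) <= lambda_0 + r],
    from [w_j + w_(m-j) = r m] in the coprime case, and from
    [w_t + w_(m-t-1) + lambda_0 = r m] when every [lambda_i] divides [m]. *)

Set Implicit Arguments.
Unset Strict Implicit.
Unset Printing Implicit Defensive.

Import Order.TTheory GRing.Theory Num.Theory.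
Local Open Scope ring_scope.

(** * Numerical semigroup *)

Lemma leq_bigminn (I : Type) (s : seq I) (F : I -> nat) t x :
  (t <= \big[minn/x]_(i <- s) F i)%N = (t <= x)%N && all (fun i => t <= F i)%N s.
Proof.
elim: s => [|i s IHs]; first by rewrite big_nil andbT.
by rewrite big_cons leq_min IHs /= andbCA.
Qed.

Lemma bigmax_natP a b (P : pred nat) (f : nat -> int) x :
  let M := \big[Num.max/x]_(a <= k < b | P k) f k in
  (forall k, (a <= k < b)%N -> P k -> f k <= M) /\
  (M = x \/ exists2 k, (a <= k < b)%N & P k /\ M = f k).
Proof.
move=> M; suff [M_ge M_ex] : (forall k, k \in index_iota a b -> P k -> f k <= M) /\
    (M = x \/ exists2 k, k \in index_iota a b & P k /\ M = f k).
  split=> [k ak|]; first by apply: M_ge; rewrite mem_index_iota.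
  by case: M_ex => [|[k]]; [left | rewrite mem_index_iota; right; exists k].
rewrite {}/M; elim: (index_iota a b) => [|k s [IHge IHex]].
  by rewrite big_nil; split; [|left].
rewrite big_cons; case: ifP => Pk; last first.
  split=> [l|]; first by rewrite inE => /predU1P[->|/IHge//]; rewrite Pk.
  case: IHex => [|[l ls lE]]; [by left | right; exists l => //].
  by rewrite inE ls orbT.
split=> [l|].
  by rewrite inE le_max => /predU1P[-> _|ls Pl]; rewrite ?lexx // IHge ?orbT.
case: leP => _; last by right; exists k; rewrite ?inE ?eqxx.
case: IHex => [|[l ls lE]]; [by left | right; exists l => //].
by rewrite inE ls orbT.
Qed.

Lemma muln_predl a b : (0 < a)%N -> (a * b = b * a.-1 + b)%N.
Proof. by case: a => // a _; rewrite mulSn mulnC addnC. Qed.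

Lemma sum_eq_modulus m x z q c : (0 < x <= m)%N -> (z < m)%N ->
  (z + (q * m + x) = m * c)%N -> (x + z = m)%N.
Proof.
move=> xm zm E; have [lecq|ltqc] := leqP c q.
  by have : (m * c <= m * q)%N by [rewrite leq_mul2l lecq orbT]; rewrite (mulnC m q); lia.
have [ltc|lec] := ltnP q.+1 c.
  by have : (m * q.+2 <= m * c)%N by [rewrite leq_mul2l ltc orbT]; rewrite !mulnS (mulnC m q); lia.
by have cE : c = q.+1 by [lia]; rewrite cE mulnS mulnC in E; lia.
Qed.

Lemma interpolate_sum r (l u : 'I_r -> nat) k : (forall i, l i <= u i)%N ->
  (\sum_(i < r) l i <= k <= \sum_(i < r) u i)%N ->
  exists2 s : 'I_r -> nat, (forall i, l i <= s i <= u i)%N & (\sum_(i < r) s i)%N = k.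
Proof.
move=> lu; elim: k => [|k IHk] /andP[lk ku].
  by exists l => [i|]; [rewrite leqnn lu | apply/eqP; rewrite -leqn0].
have [lk1|lk1] := leqP (\sum_(i < r) l i) k; last first.
  by exists l => [i|]; [rewrite leqnn lu | apply/eqP; rewrite eqn_leq lk].
have [|s lsu sk] := IHk; first by rewrite lk1 ltnW.
have [i ltsu] : exists i, (s i < u i)%N.
  apply/existsP; apply: contraTT ku; rewrite negb_exists -ltnNge => /forallP us.
  by rewrite ltnS -sk; apply: leq_sum => i _; rewrite leqNgt.
exists (fun j => s j + (j == i))%N => [j|].
  have := lsu j; case: eqP => [->|_]; last by rewrite addn0.
  by move: ltsu; lia.
by rewrite big_split /= sk (bigD1 i) //= eqxx big1 /= ?addn0 ?addn1 // => j /negPf ->.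
Qed.

Section Combinatorics.

Variables (m r : nat) (lam : 'I_r -> nat).
Hypotheses (m_gt1 : (2 <= m)%N) (r_gt1 : (2 <= r)%N).
Hypothesis lam_bounds : forall i, (1 <= lam i < m)%N.
Hypothesis m_coprime : coprime m (lambda0 lam).

Local Notation l0 := (lambda0 lam).
Local Notation eta := (kummer_eta m lam).
Local Notation eps := (kummer_epsilon m lam).

Let lam_gt0 i : (0 < lam i)%N. Proof. by case/andP: (lam_bounds i). Qed.
Let lam_ltm i : (lam i < m)%N. Proof. by case/andP: (lam_bounds i). Qed.
Let m_gt0 : (0 < m)%N. Proof. exact: ltnW. Qed.

Definition ceil_ratio t i := ((t * lam i + m.-1) %/ m)%N.
Definition ceil_sum t := (\sum_(i < r) ceil_ratio t i)%N.

(* For [H = weierstrass_semigroup Qinf], the least element of [H] that is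
   congruent to j * lambda_0 modulo m, for j < m. *)
Definition apery j := (\sum_(i < r) (j * lam i %% m))%N.

Lemma ceil_leq t i s : (ceil_ratio t i <= s)%N = (t * lam i <= s * m)%N.
Proof. by rewrite /ceil_ratio -ltnS ltn_divLR // mulSn; lia. Qed.

Lemma ceil_bounds t i :
  (t * lam i <= ceil_ratio t i * m < t * lam i + m)%N.
Proof.
rewrite -ceil_leq leqnn /=.
case: (ceil_ratio t i) (ceil_leq t i (ceil_ratio t i).-1) => [|n] /=; first lia.
by rewrite ltnn mulSn => /esym; lia.
Qed.

Lemma ceil_le_lam t i : (t <= m)%N -> (ceil_ratio t i <= lam i)%N.
Proof. by rewrite ceil_leq mulnC leq_pmul2l. Qed.

Lemma ceil_sum_mono t u : (t <= u)%N -> (ceil_sum t <= ceil_sum u)%N.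
Proof.
move=> letu; apply: leq_sum => i _; rewrite ceil_leq.
apply: leq_trans (leq_mul letu (leqnn _)) _.
by case/andP: (ceil_bounds u i).
Qed.

Lemma ceil_sum0 : ceil_sum 0 = 0%N.
Proof. by rewrite /ceil_sum big1 // => i _; apply/eqP; rewrite -leqn0 ceil_leq. Qed.

Lemma ceil_sum1 : ceil_sum 1 = r.
Proof.
rewrite /ceil_sum (eq_bigr (fun=> 1%N)) ?sum_nat_const ?card_ord ?muln1 // => i _.
apply/eqP; rewrite eqn_leq ceil_leq !mul1n (ltnW (lam_ltm i)) ltnNge ceil_leq.
by rewrite mul0n -ltnNge mul1n lam_gt0.
Qed.

Lemma ceil_sum_le t : (t <= m)%N -> (ceil_sum t <= l0)%N.
Proof. by move=> letm; apply: leq_sum => i _; apply: ceil_le_lam. Qed.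

Lemma ceil_sum_last : ceil_sum m.-1 = l0.
Proof.
apply/eqP; rewrite eqn_leq ceil_sum_le ?leq_pred //=; apply: leq_sum => i _.
rewrite leqNgt -(leq_pmul2r m_gt0).
have := ceil_bounds m.-1 i; have := lam_ltm i; have := lam_gt0 i.
move: (ceil_ratio _ _) (lam i) => c l; case: m m_gt0 => // n _ /=; nia.
Qed.

Lemma r_le_l0 : (r <= l0)%N.
Proof. by apply: leq_trans (ceil_sum_le m_gt0); rewrite ceil_sum1. Qed.

Lemma ceil_sum_ge t : (t * l0 <= ceil_sum t * m)%N.
Proof.
rewrite /ceil_sum /lambda0 big_distrr big_distrl; apply: leq_sum => i _ /=.
by case/andP: (ceil_bounds t i).
Qed.

Lemma ceil_sum_compl t : (t <= m)%N -> (ceil_sum (m - t) + ceil_sum t <= l0 + r)%N.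
Proof.
move=> letm; rewrite -[X in (_ <= _ + X)%N]card_ord -sum1_card -!big_split.
apply: leq_sum => i _ /=.
have := ceil_bounds (m - t) i; have := ceil_bounds t i.
rewrite mulnBl -(leq_pmul2r m_gt0); have := ceil_le_lam i letm.
have : (t * lam i <= m * lam i)%N by rewrite leq_pmul2r.
move: (ceil_ratio _ _) (ceil_ratio _ _) (lam i) => c c' l; nia.
Qed.

Lemma eta_geq t k : (t <= m.-1)%N -> (t <= eta k)%N = (ceil_sum t <= k)%N.
Proof.
move=> let_m; rewrite /kummer_eta.
have letm : (t <= m)%N by apply: leq_trans let_m (leq_pred m).
have C1 : (0 < t)%N -> (r <= ceil_sum t)%N.
  by move=> t_gt0; rewrite -ceil_sum1 ceil_sum_mono.
case: ltnP => [ltkr|lerk].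
  by case: t C1 {let_m letm} => [_|t]; [rewrite ceil_sum0 | move=> /(_ isT); lia].
case: (leqP l0 k) => [lel0k|ltkl0]; first by rewrite let_m (leq_trans (ceil_sum_le letm)).
apply/idP/idP => [|leCk].
  case: t let_m letm C1 => [|t] let_m letm C1; first by rewrite ceil_sum0.
  apply: contraTT; rewrite -ltnNge -leqNgt => ltkC.
  apply/bigmax_leqP => s /andP[/eqP sk /forallP sP].
  rewrite leqNgt leq_bigminn; apply: contraTN ltkC => /andP[_ /allP les].
  rewrite -leqNgt -sk; apply: leq_sum => i _; rewrite ceil_leq.
  by rewrite -leq_divRL ?les ?mem_index_enum.
case: t let_m letm C1 leCk => // t let_m letm C1 leCk.
have [|s sP sk] := @interpolate_sum r (ceil_ratio t.+1) lam k (fun i => ceil_le_lam i letm).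
  by rewrite leCk ltnW.
have lesk i : (s i <= k)%N by rewrite -sk (bigD1 i) //= leq_addr.
pose s' : {ffun 'I_r -> 'I_k.+1} := [ffun i => inord (s i)].
have s'E i : s' i = s i :> nat by rewrite ffunE inordK // ltnS.
apply: (bigop.bigmax_sup s').
  apply/andP; split; first by apply/eqP; rewrite -[RHS]sk; apply: eq_bigr.
  apply/forallP => i; rewrite s'E; have /andP[+ ->] := sP i; rewrite andbT.
  by apply: leq_trans; rewrite ltnNge ceil_leq mul0n -ltnNge muln_gt0 lam_gt0.
rewrite leq_bigminn letm; apply/allP => i _; rewrite leq_divRL // s'E -ceil_leq.
by case/andP: (sP i).
Qed.

Lemma eta_lt k : (k < l0)%N -> (eta k < m.-1)%N.
Proof. by move=> ltk; rewrite ltnNge eta_geq // ceil_sum_last -ltnNge. Qed.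

Lemma eta_ceil_sum k : (k < l0)%N -> (k < ceil_sum (eta k).+1)%N.
Proof. by move=> ltk; rewrite ltnNge -eta_geq ?eta_lt // ltnn. Qed.

Lemma eta_small : eta r.-1 = 0%N.
Proof. by rewrite /kummer_eta ifT // prednK // ltnW. Qed.

Lemma mod_ceil t i : (t <= m)%N ->
  ((m - t) * lam i %% m + t * lam i = m * ceil_ratio t i)%N.
Proof.
move=> letm; have /andP[lec ltc] := ceil_bounds t i.
have lecl := ceil_le_lam i letm.
have -> : ((m - t) * lam i = (lam i - ceil_ratio t i) * m +
    (ceil_ratio t i * m - t * lam i))%N.
  by rewrite !mulnBl; have := leq_mul lecl (leqnn m); rewrite (mulnC m); lia.
by rewrite modnMDl modn_small; [rewrite subnK // mulnC | lia].
Qed.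

Lemma apery_ceil t : (t <= m)%N -> (apery (m - t) + t * l0 = m * ceil_sum t)%N.
Proof.
move=> letm; rewrite /apery /lambda0 /ceil_sum !big_distrr -big_split.
by apply: eq_bigr => i _; apply: mod_ceil.
Qed.

Lemma apery_mod j : apery j = j * l0 %[mod m].
Proof.
by rewrite /lambda0 big_distrr /apery modn_summ.
Qed.

Lemma apery_inj j k : (j < m)%N -> (k < m)%N -> apery j = apery k %[mod m] -> j = k.
Proof.
move=> ltj ltk; rewrite !apery_mod => /eqP.
wlog lejk : j k ltj ltk / (j <= k)%N.
  by move=> H; case/orP: (leq_total j k) => ?; [|rewrite eq_sym => ?; symmetry]; apply: H.
rewrite eq_sym eqn_mod_dvd ?leq_mul2r ?lejk ?orbT // -mulnBl Gauss_dvdl //.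
by case: (posnP (k - j)) => [|kj /(dvdn_leq kj)]; lia.
Qed.

Lemma apery_residue n : exists2 j, (j < m)%N & apery j = n %[mod m].
Proof.
have l0_gt0 : (0 < l0)%N by apply: leq_trans r_le_l0; apply: ltnW.
have /coprimeP : coprime l0 m by rewrite coprime_sym.
case=> // -[u v] /= uv; exists (u * n %% m)%N; first by rewrite ltn_mod.
rewrite apery_mod modnMml mulnAC.
have -> : (u * l0 = 1 + v * m)%N by move: uv; lia.
by rewrite mulnDl mul1n mulnAC addnC modnMDl.
Qed.

Lemma apery0 : apery 0 = 0%N.
Proof. by rewrite /apery big1 // => i _; rewrite mul0n mod0n. Qed.

Lemma apery1 : apery 1 = l0.
Proof. by apply: eq_bigr => i _; rewrite mul1n modn_small. Qed.

Lemma apery_gt0 j : (0 < j < m)%N -> (0 < apery j)%N.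
Proof.
case/andP=> j_gt0 ltjm; rewrite lt0n; apply/eqP => aj0.
by have := @apery_inj j 0%N ltjm m_gt0; rewrite aj0 apery0 => /(_ erefl); lia.
Qed.

Lemma apery_lt j : (apery j < r * m)%N.
Proof.
have r_gt0 : (0 < r)%N by apply: ltnW.
rewrite -[X in (X * _)%N]card_ord -sum_nat_const.
apply: (@leq_trans (\sum_(i < r) (j * lam i %% m).+1)%N).
  rewrite (bigD1 (Ordinal r_gt0)) //= addSn ltnS /apery (bigD1 (Ordinal r_gt0)) //=.
  by rewrite leq_add2l; apply: leq_sum.
by apply: leq_sum => i _; rewrite ltn_mod.
Qed.

Lemma eps_le k : (k < l0)%N -> eps k + m%:Z <= (apery (m - (eta k).+1))%:Z.
Proof.
move=> ltk; have lte := eta_lt ltk; have ltC := eta_ceil_sum ltk.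
have := @apery_ceil (eta k).+1; rewrite /kummer_epsilon.
move=> /(_ (leq_trans lte (leq_pred m))).
move: (eta k).+1 ltC (apery _) => t; move: (ceil_sum t) => c ltC a E.
have : (m * k.+1 <= m * c)%N by rewrite leq_mul2l ltC orbT.
by rewrite mulnS mulnC; lia.
Qed.

Lemma eps_ge t : (0 < t <= m)%N ->
  [/\ (r.-1 <= (ceil_sum t).-1)%N, ((ceil_sum t).-1 < l0)%N
    & (apery (m - t))%:Z <= eps (ceil_sum t).-1 + m%:Z].
Proof.
case/andP=> t_gt0 letm; have Cr := ceil_sum_mono t_gt0; rewrite ceil_sum1 in Cr.
have Cl := ceil_sum_le letm; have C_gt0 : (0 < ceil_sum t)%N by lia.
split; [lia | lia |].
have lt_eta : (eta (ceil_sum t).-1 < t)%N.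
  have lte : (eta (ceil_sum t).-1 < m.-1)%N by apply: eta_lt; lia.
  have [let_m|] := leqP t m.-1; last lia.
  by rewrite ltnNge eta_geq // -ltnNge; lia.
have := apery_ceil letm; rewrite /kummer_epsilon.
have : (m * ceil_sum t = m * (ceil_sum t).-1 + m)%N.
  by rewrite -{1}(prednK C_gt0) mulnS addnC.
have : (l0 * (eta (ceil_sum t).-1).+1 <= l0 * t)%N by rewrite leq_mul2l lt_eta orbT.
rewrite (mulnC t); move: (apery _) (m * _)%N (m * _)%N (l0 * _)%N (l0 * _)%N.
by move=> a b c d e; lia.
Qed.

Section Semigroup.

Variable H : nat -> Prop.
Hypothesis H_mem : forall j a, H (m * a + apery j)%N.
Hypothesis H_sub : forall s, H s -> exists j a, (j < m)%N /\ s = (m * a + apery j)%N.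

Let top := (\max_(j < m) apery j)%N.

Let le_top j : (j < m)%N -> (apery j <= top)%N.
Proof. by move=> ltj; apply: (leq_bigmax (Ordinal ltj)). Qed.

Let top_ex : exists2 j, (j < m)%N & apery j = top.
Proof.
have [|j jE] := @bigop.eq_bigmax 'I_m (fun j => apery j); first by rewrite card_ord.
by exists j.
Qed.

Let lt_top : (m < top)%N.
Proof.
have [j ltj aj1] := apery_residue 1; apply: leq_trans (le_top ltj).
have co_j : coprime m j.
  have : coprime m (j * l0).
    by rewrite -coprime_modr -apery_mod aj1 coprime_modr coprimen1.
  by rewrite coprimeMr => /andP[].
have a_gt1 : (1 < apery j)%N.
  apply: leq_trans r_gt1 _; rewrite -[r in (r <= _)%N]card_ord -sum1_card.
  apply: leq_sum => i _; rewrite lt0n -/(m %| _)%N Gauss_dvdr //.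
  by rewrite gtnNdvd.
rewrite [RHS]modn_small // in aj1.
have := divn_eq (apery j) m; rewrite aj1; case: (apery j %/ m)%N => [|n]; first lia.
by rewrite mulSn; lia.
Qed.

Let F := (top - m)%N.

Lemma frobeniusP : is_frobenius_number H F.
Proof.
have [j0 ltj0 j0E] := top_ex; split; first by rewrite subn_gt0.
  case/H_sub=> j [a [ltj FE]].
  have topE : top = (m * a.+1 + apery j)%N by have := lt_top; rewrite mulnS /F in FE *; lia.
  have jj : j = j0.
    by apply: apery_inj => //; rewrite j0E topE mulnC modnMDl.
  by move: topE; rewrite -j0E jj mulnS; lia.
move=> n n_gt0 nHn; have [j ltj jE] := apery_residue n.
have [lean|ltna] := leqP (apery j) n.
  case: nHn; have /dvdnP [a aE] : (m %| n - apery j)%N.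
    by rewrite -eqn_mod_dvd //; apply/eqP.
  by have := H_mem j a; rewrite mulnC -aE subnK.
have /dvdnP [[|a] aE] : (m %| apery j - n)%N by rewrite -eqn_mod_dvd ?(ltnW ltna) //; apply/eqP.
  by move: aE ltna; lia.
by have := le_top ltj; move: aE; rewrite mulSn /F; lia.
Qed.

Lemma multiplicity_le mu : is_multiplicity H mu ->
  (mu <= m)%N /\ forall j, (0 < j < m)%N -> (mu <= apery j)%N.
Proof.
case=> _ _ min_mu; split.
  by apply: min_mu => //; have := H_mem 0 1; rewrite muln1 apery0 addn0.
move=> j ltj; apply: min_mu; first exact: apery_gt0.
by have := H_mem j 0; rewrite muln0.
Qed.

Lemma multiplicity_cases mu : is_multiplicity H mu ->
  mu = m \/ exists2 j, (0 < j < m)%N & mu = apery j.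
Proof.
move=> muP; have [le_m le_j] := multiplicity_le muP.
case: muP => mu_gt0 /H_sub [j [a [ltj muE]]] _.
case: (posnP j) => [j0|j_gt0].
  left; move: mu_gt0 le_m; rewrite muE j0 apery0 addn0 muln_gt0 => /andP[_ a_gt0] le_m.
  by apply/eqP; rewrite eqn_leq le_m leq_pmulr.
right; exists j; first by rewrite j_gt0.
have := le_j j; rewrite j_gt0 ltj => /(_ isT); rewrite muE.
by rewrite -[X in (_ <= X)%N]add0n leq_add2r leqn0 => /eqP ->.
Qed.

Lemma multiplicity_ex : exists mu, is_multiplicity H mu.
Proof.
pose P n := `[< (0 < n)%N /\ H n >].
have ex : exists n, P n.
  exists m; apply/asboolP; split=> //.
  by have := H_mem 0 1; rewrite muln1 apery0 addn0.
case: (ex_minnP ex) => mu /asboolP [mu_gt0 Hmu] min_mu; exists mu; split=> // n n_gt0 Hn.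
by apply: min_mu; apply/asboolP.
Qed.

Lemma eps_le_F k : (k < l0)%N -> eps k <= F%:Z.
Proof.
move=> ltk; have := eps_le ltk; have lte := eta_lt ltk.
have := @le_top (m - (eta k).+1)%N; rewrite ltn_subrL => /(_ m_gt0).
by have := lt_top; rewrite /F; lia.
Qed.

Lemma eps_F_ex : exists2 k, (r.-1 <= k < l0)%N & eps k = F%:Z.
Proof.
have [j ltj jE] := top_ex; have top_gt := lt_top.
have tm : (0 < m - j <= m)%N by rewrite subn_gt0 ltj leq_subr.
have [rk lk] := eps_ge tm; rewrite subKn ?(ltnW ltj) // jE => le_eps.
exists (ceil_sum (m - j)).-1; first by rewrite rk.
by have := eps_le_F lk; rewrite /F in le_eps *; lia.
Qed.

Lemma eps_lt k : (k < l0)%N -> eps k + m%:Z < (r * m)%N%:Z.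
Proof. by move/eps_le; have := apery_lt (m - (eta k).+1); lia. Qed.

Lemma eps_small : eps r.-1 + m%:Z = (r * m)%N%:Z - l0%:Z.
Proof.
by rewrite /kummer_epsilon eta_small muln1 (muln_predl m (ltnW r_gt1)); lia.
Qed.

Lemma frobenius_max :
  F%:Z = \big[Num.max/eps r.-1]_(r.-1 <= k < l0
            | eta k == ((k + 1 - r) * m %/ l0)%N) eps k.
Proof.
have [k kr kF] := eps_F_ex; have /andP[rk lk] := kr.
have lr : (r.-1 < l0)%N by have := r_le_l0; lia.
have [] := bigmax_natP r.-1 l0 (fun k => eta k == ((k + 1 - r) * m %/ l0)%N) eps (eps r.-1).
set M := \big[_/_]_(_ <= _ < _ | _) _ => M_ge M_ex.
apply/eqP; rewrite eq_le; apply/andP; split; last first.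
  case: M_ex => [->|[i /andP[_ ltil0] [_ ->]]]; exact: eps_le_F.
rewrite -kF; apply: M_ge => //.
have l0_gt0 : (0 < l0)%N by lia.
rewrite eq_sym eqn_leq -ltnS ltn_divLR // leq_divRL //.
have := eps_lt lk; have := eps_le_F lr; have := eps_small.
rewrite -kF /kummer_epsilon mulnBl mulnDl mul1n.
rewrite -(mulnC l0 (eta k)) -(mulnC l0 (eta k).+1) !mulnS.
rewrite (mulnC k).
move: (m * k)%N (r * m)%N (l0 * eta k)%N (m * r.-1)%N (l0 * _)%N => A B C D X.
by lia.
Qed.

Lemma frobenius_eps_small :
  F%:Z = eps r.-1 <->
    (forall s, (r <= s <= l0.-1)%N ->
       (eta s + eta (r + l0 - 1 - s) = m - 1)%N ->
       (eta s < s * m %/ l0)%N).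
Proof.
have l0_gt0 : (0 < l0)%N by have := r_le_l0; lia.
split=> [FE s /andP[ers sl] etas|bad].
  rewrite ltnNge; apply/negP => le_eta.
  pose k := (r + l0 - 1 - s)%N; have lk : (k < l0)%N by rewrite /k; lia.
  have := eps_le_F lk; have := eps_small; rewrite FE /kummer_epsilon.
  have : (s * m < (eta s).+1 * l0)%N by rewrite -ltn_divLR // ltnS.
  have : (k * m + s * m + m = r * m + l0 * m)%N.
    by rewrite -mulnDl -mulSnr -mulnDl /k; congr (_ * _)%N; lia.
  have : ((eta k).+1 * l0 + (eta s).+1 * l0 = l0 * m + l0)%N.
    rewrite -mulnDl mulnC -mulnSr; congr (_ * _)%N.
    by move: etas; rewrite -/k; lia.
  rewrite (mulnC m k) (mulnC l0 (eta k).+1).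
  move: (k * m)%N (s * m)%N (r * m)%N (l0 * m)%N (_ * l0)%N (_ * l0)%N => A B C D X Y.
  by lia.
have lr : (r.-1 < l0)%N by have := r_le_l0; lia.
apply/eqP; rewrite eq_le eps_le_F // andbT leNgt; apply/negP => ltF.
have [k /andP[rk lk] kF] := eps_F_ex.
have nk : k != r.-1 by apply: contraTneq ltF => kr; rewrite -kF kr ltxx.
have {nk rk} rk : (r <= k)%N by lia.
have lte := eta_lt lk; set t := (eta k).+1.
have letm : (t <= m)%N by rewrite /t; lia.
have kC : k.+1 = ceil_sum t.
  apply/eqP; rewrite eqn_leq eta_ceil_sum //= -(leq_pmul2l m_gt0).
  have := @le_top (m - t)%N; rewrite ltn_subrL m_gt0 => /(_ isT).
  have := apery_ceil letm; move: kF; rewrite /kummer_epsilon -/t /F mulnS (mulnC t).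
  move: (apery _) (m * k)%N (m * _)%N (l0 * _)%N => A B C D; have := lt_top.
  by lia.
have t_gt1 : (1 < t)%N.
  by rewrite /t ltnS ltnNge -ltnS; have := eta_geq k (t := 1); rewrite ceil_sum1 rk; lia.
pose s := (r + l0 - ceil_sum t)%N.
have Cl := ceil_sum_le letm.
have ms : (s * m < (m - t).+1 * l0)%N.
  have : (s * m + k * m + m = r * m + l0 * m)%N.
    by rewrite -mulnDl -mulSnr -mulnDl /s -kC; congr (_ * _)%N; lia.
  have : ((m - t).+1 * l0 + t * l0 = m * l0 + l0)%N.
    by rewrite -mulnDl -mulSnr; congr (_ * _)%N; lia.
  move: ltF; have := eps_small; rewrite -kF /kummer_epsilon -/t.
  rewrite (mulnC m k) (mulnC l0 t) (mulnC l0 m).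
  by lia.
have eta_s : eta s = (m - t)%N.
  apply/eqP; rewrite eqn_leq; apply/andP; split; last first.
    rewrite eta_geq; last by lia.
    by have := ceil_sum_compl letm; rewrite /s; lia.
  rewrite -ltnS ltnNge eta_geq; last by lia.
  rewrite -ltnNge -(ltn_pmul2r m_gt0); apply: leq_trans ms _.
  exact: ceil_sum_ge.
have rsk : (r + l0 - 1 - s = k)%N by rewrite /s -kC; lia.
have := bad s; rewrite rsk eta_s => H1.
have : (m - t < s * m %/ l0)%N.
  by apply: H1; rewrite /s -?kC /t; lia.
by rewrite leq_divRL // leqNgt ms.
Qed.

Lemma multiplicity_coprime mu : is_multiplicity H mu ->
  (forall j, coprime m (lam j)) ->
  mu%:Z = Num.min m%:Z ((m * r.-1)%N%:Z - F%:Z).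
Proof.
move=> muP co_lam; have [le_m le_j] := multiplicity_le muP.
have compl j : (0 < j < m)%N -> (apery j + apery (m - j) = r * m)%N.
  case/andP=> j_gt0 ltj; rewrite -[X in (X * _)%N]card_ord -sum_nat_const -big_split.
  apply: eq_bigr => i _ /=; have E := mod_ceil i (ltnW ltj).
  rewrite [X in (_ + X)%N](divn_eq _ m) in E.
  apply: sum_eq_modulus E; last by rewrite ltn_mod.
  rewrite (ltnW (ltn_pmod _ m_gt0)) andbT lt0n -/(m %| _)%N Gauss_dvdl //.
  by rewrite gtnNdvd.
have r_gt0 : (0 < r)%N by apply: ltnW.
have rm := muln_predl m r_gt0.
have top_gt := lt_top.
have [j0 ltj0 j0E] := top_ex.
have j0_gt0 : (0 < j0)%N.
  by rewrite lt0n; apply: contraTneq top_gt => j00; rewrite -j0E j00 apery0.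
have := compl j0; rewrite j0_gt0 ltj0 j0E => /(_ isT) j0C.
have := le_j (m - j0)%N; rewrite subn_gt0 ltj0 ltn_subrL j0_gt0 m_gt0 => /(_ isT) le0.
have [mum|[j /andP[j_gt0 ltj] muj]] := multiplicity_cases muP.
  by rewrite mum min_l // -mum /F; lia.
have := compl j; rewrite j_gt0 ltj => /(_ isT) jC.
have := @le_top (m - j)%N; rewrite ltn_subrL j_gt0 m_gt0 => /(_ isT) lej.
by rewrite muj min_r /F; lia.
Qed.

Lemma multiplicity_dvd mu : is_multiplicity H mu -> (forall j, lam j %| m)%N ->
  mu%:Z = if r == l0 then Num.min m%:Z l0%:Z
          else Num.min m%:Z (Num.min l0%:Z
                 (eps r.-1 - \big[Num.max/eps r]_(r <= k < l0) eps k)).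
Proof.
move=> muP dvd_lam; have [le_m le_j] := multiplicity_le muP.
have le_l0 : (mu <= l0)%N by have := le_j 1%N; rewrite apery1 => ->.
have compl t : (t < m)%N -> (apery t + apery (m - t.+1) + l0 = r * m)%N.
  move=> ltt; rewrite -[X in (X * _)%N]card_ord -sum_nat_const /lambda0 -!big_split.
  apply: eq_bigr => i _ /=; have E := mod_ceil i ltt.
  rewrite mulSn [X in (_ + (_ + X))%N](divn_eq _ m) in E.
  have ltx : (t * lam i %% m < m)%N by rewrite ltn_mod.
  have /dvdnP [u mE] := dvd_lam i.
  have /dvdnP [x xE] : (lam i %| t * lam i %% m)%N.
    by rewrite /dvdn modn_dvdm ?dvd_lam ?modnMl.
  have lexl : (0 < t * lam i %% m + lam i <= m)%N.
    rewrite addn_gt0 lam_gt0 orbT /=; move: ltx; rewrite xE mE.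
    by rewrite ltn_pmul2r ?lam_gt0 // addnC -mulSn leq_pmul2r ?lam_gt0.
  rewrite addnAC; apply: (sum_eq_modulus (q := (t * lam i %/ m)%N) (c := ceil_ratio t.+1 i) lexl).
    by rewrite ltn_mod.
  by rewrite -E; lia.
have bound t : (0 < t < m)%N ->
    (l0 <= apery t)%N \/ exists2 k, (r <= k < l0)%N & eps r.-1 - eps k <= (apery t)%:Z.
  case/andP=> t_gt0 ltt; have tm : (0 < t.+1 <= m)%N by [].
  have [rk lk le_eps] := eps_ge tm; have cE := compl t ltt; have sE := eps_small.
  have [Cr|rC] := leqP (ceil_sum t.+1) r; [left | right].
    have := apery_ceil ltt; have : (m * ceil_sum t.+1 <= m * r)%N by rewrite leq_mul2l Cr orbT.
    have : (l0 <= t * l0)%N by rewrite leq_pmull.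
    rewrite mulSn (mulnC m r); move: (m * _)%N (r * m)%N (t * l0)%N cE => A B C.
    by lia.
  exists (ceil_sum t.+1).-1; first by lia.
  by lia.
have low k : (r <= k < l0)%N -> mu%:Z <= eps r.-1 - eps k.
  case/andP=> rk lk; have lte := eta_lt lk; have e_gt0 : (0 < eta k)%N.
    by rewrite eta_geq ?ceil_sum1 //; lia.
  have := le_j (eta k); rewrite e_gt0 => /(_ _) le_e.
  have ltm : (eta k < m)%N by lia.
  have := compl (eta k) ltm; have := le_e ltm; have := eps_le lk; have := eps_small.
  by lia.
case: eqP => [rl|nrl].
  have [mum|[j jm muj]] := multiplicity_cases muP; first by rewrite mum min_l // -mum; lia.
  case: (bound j jm) => [lej|[k /andP[rk]]]; last by rewrite -rl ltnNge rk.
  by rewrite min_r; lia.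
have rltl : (r < l0)%N by have := r_le_l0; lia.
have [M_ge M_ex] := bigmax_natP r l0 predT eps (eps r).
have lowM : mu%:Z <= eps r.-1 - \big[Num.max/eps r]_(r <= k < l0) eps k.
  by case: M_ex => [->|[k kr [_ ->]]]; apply: low; rewrite ?leqnn.
apply/eqP; rewrite eq_le !le_min !ge_min lowM !lez_nat le_m le_l0 /=.
have [->|[j jm ->]] := multiplicity_cases muP; first by rewrite leqnn.
case: (bound j jm) => [->|[k kr le_k]]; first by rewrite !orbT.
by apply/or3P/Or33; apply: le_trans le_k; rewrite lerB // M_ge.
Qed.

End Semigroup.
End Combinatorics.

(** * Power series *)

Record pseries (K : fieldType) := PSeries { pcoef : nat -> K }.

HB.instance Definition _ (K : fieldType) := gen_eqMixin (pseries K).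
HB.instance Definition _ (K : fieldType) := gen_choiceMixin (pseries K).

Section PowerSeries.

Variable K : fieldType.
Implicit Types f g h : pseries K.

Lemma pseriesP f g : (forall n, pcoef f n = pcoef g n) -> f = g.
Proof. by case: f => f; case: g => g /= /funext ->. Qed.

Definition ps_trunc N f : {poly K} := \poly_(i < N) pcoef f i.

Definition ps_zero : pseries K := PSeries (fun=> 0).
Definition ps_opp f := PSeries (fun n => - pcoef f n).
Definition ps_add f g := PSeries (fun n => pcoef f n + pcoef g n).
Definition ps_one : pseries K := PSeries (fun n => (n == 0)%:R).
Definition ps_mul f g :=
  PSeries (fun n => \sum_(i < n.+1) pcoef f i * pcoef g (n - i)).

Fact ps_addA : associative ps_add.
Proof. by move=> f g h; apply: pseriesP => n /=; rewrite addrA. Qed.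
Fact ps_addC : commutative ps_add.
Proof. by move=> f g; apply: pseriesP => n /=; rewrite addrC. Qed.
Fact ps_add0 : left_id ps_zero ps_add.
Proof. by move=> f; apply: pseriesP => n /=; rewrite add0r. Qed.
Fact ps_addN : left_inverse ps_zero ps_opp ps_add.
Proof. by move=> f; apply: pseriesP => n /=; rewrite addNr. Qed.

HB.instance Definition _ :=
  GRing.isZmodule.Build (pseries K) ps_addA ps_addC ps_add0 ps_addN.

Lemma pcoef_mul_trunc N n f g : (n < N)%N ->
  pcoef (ps_mul f g) n = (ps_trunc N f * ps_trunc N g)`_n.
Proof.
move=> ltnN; rewrite coefM; apply: eq_bigr => i _.
by rewrite !coef_poly !ifT //; have := ltn_ord i; lia.
Qed.

Lemma ps_trunc_mul N f g :
  ps_trunc N (ps_mul f g) = take_poly N (ps_trunc N f * ps_trunc N g).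
Proof.
apply/polyP => n; rewrite coef_take_poly coef_poly.
by case: ifP => // ltnN; apply: pcoef_mul_trunc.
Qed.

Lemma coef_take_mul N n (p q : {poly K}) : (n < N)%N ->
  (take_poly N p * q)`_n = (p * q)`_n.
Proof.
move=> ltnN; rewrite !coefM; apply: eq_bigr => i _.
by rewrite coef_take_poly ifT //; have := ltn_ord i; lia.
Qed.

Fact ps_mulC : commutative ps_mul.
Proof.
move=> f g; apply: pseriesP => n.
by rewrite !(@pcoef_mul_trunc n.+1) // mulrC.
Qed.

Fact ps_mulA : associative ps_mul.
Proof.
move=> f g h; apply: pseriesP => n.
rewrite !(@pcoef_mul_trunc n.+1) // !ps_trunc_mul mulrC !coef_take_mul //.
by rewrite mulrC mulrA.
Qed.

Fact ps_mul1 : left_id ps_one ps_mul.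
Proof.
move=> f; apply: pseriesP => n /=.
rewrite big_ord_recl /= mul1r subn0 big1 ?addr0 // => i _.
by rewrite mul0r.
Qed.

Fact ps_mulDl : left_distributive ps_mul ps_add.
Proof.
move=> f g h; apply: pseriesP => n /=; rewrite -big_split /=.
by apply: eq_bigr => i _; rewrite mulrDl.
Qed.

Fact ps_one_neq0 : ps_one != 0 :> pseries K.
Proof.
by apply/eqP => /(congr1 (fun f => pcoef f 0)) /eqP; rewrite /= oner_eq0.
Qed.

HB.instance Definition _ := GRing.Zmodule_isComNzRing.Build (pseries K)
  ps_mulA ps_mulC ps_mul1 ps_mulDl ps_one_neq0.


Definition ps_unit f : bool := `[< exists g, g * f = 1 >].
Definition ps_inv f : pseries K :=
  if pselect (exists g, g * f = 1) is left ex then sval (cid ex) else f.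

Fact ps_mulVf : {in ps_unit, left_inverse 1 ps_inv *%R}.
Proof.
move=> f /asboolP ex; rewrite /ps_inv.
by case: pselect => // ex'; case: (cid ex').
Qed.

Fact ps_unitPl f g : g * f = 1 -> ps_unit f.
Proof. by move=> gf1; apply/asboolP; exists g. Qed.

Fact ps_inv_out : {in [predC ps_unit], ps_inv =1 id}.
Proof.
by move=> f nf; rewrite /ps_inv; case: pselect => // ex; case/asboolP: nf.
Qed.

HB.instance Definition _ := GRing.ComNzRing_hasMulInverse.Build (pseries K)
  ps_mulVf ps_unitPl ps_inv_out.

Definition ps_ord f : nat :=
  if pselect (exists n, pcoef f n != 0) is left ex then ex_minn ex else 0%N.

Lemma pcoefD f g n : pcoef (f + g) n = pcoef f n + pcoef g n.
Proof. by []. Qed.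

Lemma pcoefM f g n :
  pcoef (f * g) n = \sum_(i < n.+1) pcoef f i * pcoef g (n - i).
Proof. by []. Qed.

Lemma pseries_neq0P f : reflect (exists n, pcoef f n != 0) (f != 0).
Proof.
apply: (iffP idP) => [nf0|[n]]; last by apply: contraNneq => ->.
apply: contrapT => /forallNP f0; case/eqP: nf0.
apply: pseriesP => n; change (pcoef f n = 0).
by apply: contrapT => /eqP /f0.
Qed.

Lemma ps_ordP f : f != 0 ->
  pcoef f (ps_ord f) != 0 /\ forall n, (n < ps_ord f)%N -> pcoef f n = 0.
Proof.
move/pseries_neq0P => ex; rewrite /ps_ord; case: pselect => // ex'.
case: ex_minnP => n fn minn; split=> // i ltin; apply/eqP; apply: contraLR ltin.
by move=> /minn; rewrite -leqNgt.
Qed.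

Lemma ps_ord_eq f n : pcoef f n != 0 ->
  (forall i, (i < n)%N -> pcoef f i = 0) -> ps_ord f = n.
Proof.
move=> fn f0; have nf0 : f != 0 by apply/pseries_neq0P; exists n.
have [ford minf] := ps_ordP nf0; case: (ltngtP (ps_ord f) n) => // H.
  by rewrite f0 ?eqxx in ford.
by rewrite minf ?eqxx in fn.
Qed.

Lemma ps_ordM_coef f g : f != 0 -> g != 0 ->
  pcoef (f * g) (ps_ord f + ps_ord g) != 0 /\
  forall n, (n < ps_ord f + ps_ord g)%N -> pcoef (f * g) n = 0.
Proof.
move=> /ps_ordP [fo f0] /ps_ordP [go g0]; split=> [|n ltn]; last first.
  rewrite pcoefM big1 // => i _; case: (ltnP i (ps_ord f)) => Hi.
    by rewrite f0 ?mul0r.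
  by rewrite g0 ?mulr0 //; have := ltn_ord i; lia.
have lto : (ps_ord f < (ps_ord f + ps_ord g).+1)%N by lia.
rewrite pcoefM (bigD1 (Ordinal lto)) //= big1 ?addr0 => [|i].
  by rewrite mulf_neq0 // addKn.
rewrite -val_eqE /= => ni; case: (ltnP i (ps_ord f)) => Hi.
  by rewrite f0 ?mul0r.
by rewrite g0 ?mulr0 //; have := ltn_ord i; lia.
Qed.

Fact ps_integral : GRing.integral_domain_axiom (pseries K).
Proof.
move=> f g fg0; apply/norP => -[nf ng].
by have [] := ps_ordM_coef nf ng; rewrite fg0 eqxx.
Qed.

HB.instance Definition _ :=
  GRing.ComUnitRing_isIntegral.Build (pseries K) ps_integral.

Lemma ps_ordM f g : f != 0 -> g != 0 -> ps_ord (f * g) = (ps_ord f + ps_ord g)%N.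
Proof. by move=> nf ng; have [] := ps_ordM_coef nf ng; apply: ps_ord_eq. Qed.

Lemma ps_ordD f g : f != 0 -> g != 0 -> f + g != 0 ->
  (minn (ps_ord f) (ps_ord g) <= ps_ord (f + g)%R)%N.
Proof.
move=> /ps_ordP [_ f0] /ps_ordP [_ g0] /ps_ordP [nfg _].
rewrite leqNgt; apply: contraNN nfg; rewrite leq_min => /andP[lf lg].
by rewrite pcoefD f0 // g0 // addr0.
Qed.

Definition ps_poly (p : {poly K}) : pseries K := PSeries (fun n => p`_n).

Fact ps_poly_zmod : zmod_morphism ps_poly.
Proof. by move=> p q; apply: pseriesP => n /=; rewrite coefB. Qed.

Fact ps_poly_monoid : monoid_morphism ps_poly.
Proof.
split=> [|p q]; apply: pseriesP => n /=; first by rewrite coef1.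
by rewrite coefM.
Qed.

HB.instance Definition _ :=
  GRing.isZmodMorphism.Build {poly K} (pseries K) ps_poly ps_poly_zmod.
HB.instance Definition _ :=
  GRing.isMonoidMorphism.Build {poly K} (pseries K) ps_poly ps_poly_monoid.

Lemma ps_poly_eq0 (p : {poly K}) : (ps_poly p == 0) = (p == 0).
Proof.
apply/eqP/eqP => [p0|->]; last exact: rmorph0.
by apply/polyP => n; have := congr1 (fun f => pcoef f n) p0; rewrite coef0.
Qed.

Lemma ps_ord_polyXn n (p : {poly K}) : p`_0 != 0 -> ps_ord (ps_poly ('X^n * p)) = n.
Proof.
move=> p0; apply: ps_ord_eq => [|i ltin] /=; rewrite coefXnM ?ltnn ?subnn //.
by rewrite ltin.
Qed.

Lemma pcoefX_eq N f g k : (forall n, (n < N)%N -> pcoef f n = pcoef g n) ->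
  forall n, (n < N)%N -> pcoef (f ^+ k) n = pcoef (g ^+ k) n.
Proof.
move=> fg; elim: k => [//|k IHk] n ltn; rewrite !exprS !pcoefM.
by apply: eq_bigr => i _; rewrite fg ?IHk //; have := ltn_ord i; lia.
Qed.

End PowerSeries.

Lemma exprD_modsq (R : comNzRingType) (a b : R) n :
  exists c, (a + b) ^+ n = a ^+ n + (a ^+ n.-1 * b) *+ n + b ^+ 2 * c.
Proof.
elim: n => [|n [c IHn]]; first by exists 0; rewrite !expr0 mulr0n mulr0 !addr0.
exists ((a + b) * c + (a ^+ n.-1) *+ n).
rewrite exprS IHn; case: n {IHn} => [|n].
  by rewrite !expr0 !mulr0n; ring.
rewrite [_ *+ n.+2]mulrS [n.+2.-1]/= [n.+1.-1]/= !exprS.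
have -> : a * a ^+ n * b *+ n.+1 = a * (a ^+ n *+ n.+1) * b.
  by rewrite mulrnAr mulrnAl.
rewrite -mulrnAl; move: (a ^+ n) => u; move: (u *+ n.+1) => k.
ring.
Qed.

Lemma ps_root (K : closedFieldType) (m : nat) (g : {poly K}) :
  (0 < m)%N -> m%:R != 0 :> K -> g`_0 != 0 ->
  exists2 h : pseries K, h ^+ m = ps_poly g & pcoef h 0 != 0.
Proof.
move=> m_gt0 m_neq0 g0.
have [c0 c0P] : exists c0, root ('X^m - (g`_0)%:P) c0.
  by apply/closed_rootP; rewrite size_XnsubC //; case: m m_gt0 {m_neq0}.
have {}c0P : c0 ^+ m = g`_0.
  by move: c0P; rewrite /root hornerD hornerN hornerXn hornerC subr_eq0 => /eqP.
have c0_neq0 : c0 != 0.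
  apply: contraNneq g0 => c00; rewrite -c0P c00 expr0n.
  by case: m m_gt0 {m_neq0 c0P}.
pose step N (h : {poly K}) :=
  h - ((h ^+ m - g)`_N / (c0 ^+ m.-1 *+ m))%:P * 'X^N.
pose fix hs N := if N is N'.+1 then step N (hs N') else c0%:P.
have hsP N : (hs N)`_0 = c0 /\ exists q, hs N ^+ m - g = 'X^(N.+1) * q.
  elim: N => [|N [h0 [q hq]]].
    split; first by rewrite /= coefC.
    have : root (c0%:P ^+ m - g) 0.
      by rewrite /root hornerD hornerN horner_exp hornerC c0P horner_coef0 subrr.
    by case/factor_theorem => q; rewrite subr0 mulrC => ->; exists q.
  set h := hs N in h0 hq *; have hh : hs N.+1 = step N.+1 h by [].
  set c := ((h ^+ m - g)`_N.+1 / (c0 ^+ m.-1 *+ m)).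
  have {}hh : hs N.+1 = h + (- c)%:P * 'X^(N.+1).
    by rewrite hh /step -/c polyCN mulNr.
  split; first by rewrite hh coefD coefMXn /= addr0.
  have cE : c = q`_0 / (c0 ^+ m.-1 *+ m) by rewrite /c hq coefXnM ltnn subnn.
  have [d dP] := exprD_modsq h ((- c)%:P * 'X^(N.+1)) m.
  have : root (q + (h ^+ m.-1 * (- c)%:P) *+ m) 0.
    rewrite /root hornerD hornerMn hornerM horner_exp hornerC !horner_coef0 h0.
    rewrite -mulrnAl cE mulrN mulrCA divff ?mulr1 ?subrr //.
    by rewrite -mulr_natr mulf_neq0 // expf_neq0.
  case/factor_theorem => q'; rewrite subr0 => q'P.
  exists (q' + ((- c)%:P) ^+ 2 * 'X^N * d).
  rewrite hh dP.
  have -> : h ^+ m = 'X^(N.+1) * q + g by rewrite -hq subrK.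
  rewrite exprMn -exprM muln2 -addnn.
  have -> : 'X^(N.+2) * (q' + (- c)%:P ^+ 2 * 'X^N * d) =
    'X^(N.+1) * (q' * 'X) + (- c)%:P ^+ 2 * ('X^(N.+1) * 'X^(N.+1)) * d.
    by rewrite !exprS; ring.
  by rewrite -q'P -exprD; ring.
pose h := PSeries (fun n => (hs n)`_n).
have hsS N n : (n <= N)%N -> (hs N)`_n = (hs n)`_n.
  elim: N => [|N IHN]; first by rewrite leqn0 => /eqP ->.
  rewrite leq_eqVlt => /predU1P[-> //|ltnN].
  have -> : hs N.+1 = step N.+1 (hs N) by [].
  by rewrite /step coefB coefMXn ltnN subr0 IHN.
exists h; last by have [/= -> _] := hsP 0%N.
apply: pseriesP => n.
rewrite (@pcoefX_eq _ n.+1 h (ps_poly (hs n))) //; last first.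
  by move=> i; rewrite ltnS => lein; exact: esym (hsS _ _ lein).
have [_ [q hq]] := hsP n.
rewrite -rmorphXn /=; apply/eqP; rewrite -subr_eq0 -coefB hq coefXnM.
by rewrite ltnSn.
Qed.

(** * Valuations and places *)

Definition is_valuation (E : fieldType) (v : E -> int) : Prop :=
  (forall u w, u != 0 -> w != 0 -> v (u * w) = v u + v w) /\
  (forall u w, u != 0 -> w != 0 -> u + w != 0 ->
     Num.min (v u) (v w) <= v (u + w)).

Section Valuation.

Variables (E : fieldType) (v : E -> int).
Hypothesis v_val : is_valuation v.

Lemma valM u w : u != 0 -> w != 0 -> v (u * w) = v u + v w.
Proof. by case: v_val => + _; apply. Qed.

Lemma valD c u w : u != 0 -> w != 0 -> u + w != 0 ->
  c <= v u -> c <= v w -> c <= v (u + w).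
Proof.
case: v_val => _ vD nu nw nuw cu cw; apply: le_trans (vD u w nu nw nuw).
by rewrite le_min cu cw.
Qed.

Lemma val1 : v 1 = 0.
Proof. by have := @valM 1 1 (oner_neq0 _) (oner_neq0 _); rewrite mulr1; lia. Qed.

Lemma valV u : u != 0 -> v u^-1 = - v u.
Proof.
move=> nu; have := @valM u u^-1 nu; rewrite invr_neq0 // mulfV // val1.
by move=> /(_ isT); lia.
Qed.

Lemma val_exp u n : u != 0 -> v (u ^+ n) = n%:Z * v u.
Proof.
move=> nu; elim: n => [|n IHn]; first by rewrite expr0 val1 mul0r.
by rewrite exprS valM ?expf_neq0 // IHn; lia.
Qed.

Lemma val_prod (I : Type) (s : seq I) (F : I -> E) :
  (forall i, F i != 0) -> v (\prod_(i <- s) F i) = \sum_(i <- s) v (F i).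
Proof.
move=> nF; elim: s => [|i s IHs]; first by rewrite !big_nil val1.
rewrite !big_cons valM ?IHs // prodf_seq_neq0.
by elim: (s) => //= j s' ->; rewrite nF.
Qed.

Lemma valN u : u != 0 -> v (- u) = v u.
Proof.
move=> nu; have nN1 : -1 != 0 :> E by rewrite oppr_eq0 oner_neq0.
have vN1 : v (-1) = 0 by have := valM nN1 nN1; rewrite mulrNN mulr1 val1; lia.
by rewrite -mulN1r valM // vN1 add0r.
Qed.

Lemma val_sum_ge (I : finType) (P : pred I) (F : I -> E) c :
  (forall i, P i -> F i != 0 -> c <= v (F i)) ->
  \sum_(i | P i) F i = 0 \/ c <= v (\sum_(i | P i) F i).
Proof.
move=> cF; apply: (big_ind (fun s => s = 0 \/ c <= v s)); first by left.
  move=> a b; have [->|na] := eqVneq a 0; first by rewrite add0r.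
  have [->|nb] := eqVneq b 0; first by rewrite addr0.
  case=> [a0|ca]; first by rewrite a0 eqxx in na.
  case=> [b0|cb]; first by rewrite b0 eqxx in nb.
  have [->|nab] := eqVneq (a + b) 0; [by left | right].
  exact: valD.
move=> i Pi; have [->|nF] := eqVneq (F i) 0; [by left | right].
exact: cF.
Qed.

Lemma valD_lt u w : u != 0 -> w = 0 \/ v u < v w ->
  u + w != 0 /\ v (u + w) = v u.
Proof.
move=> nu; have [-> _|nw [w0|vuw]] := eqVneq w 0; first by rewrite addr0.
  by rewrite w0 eqxx in nw.
have nuw : u + w != 0.
  by apply: contraTneq vuw => /eqP; rewrite addr_eq0 => /eqP ->; rewrite valN // ltxx.
split=> //; apply/eqP; rewrite eq_le valD ?(ltW vuw) // andbT leNgt.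
apply/negP => lt_u; have := @valD (v u + 1) (u + w) (- w) nuw.
by rewrite oppr_eq0 addrK valN // => /(_ nw nu); lia.
Qed.

Lemma val_sum_distinct (I : finType) (P : pred I) (F : I -> E) i0 :
  P i0 -> (forall i, P i -> F i != 0) ->
  (forall i j, P i -> P j -> v (F i) = v (F j) -> i = j) ->
  exists i, [/\ P i, \sum_(j | P j) F j != 0,
    v (\sum_(j | P j) F j) = v (F i) & forall j, P j -> v (F i) <= v (F j)].
Proof.
move=> Pi0 nF injF.
have [i Pi mini] := @arg_minP _ _ _ i0 P (fun i => v (F i)) Pi0.
have rest : \sum_(j | P j && (j != i)) F j = 0 \/
    v (F i) + 1 <= v (\sum_(j | P j && (j != i)) F j).
  apply: val_sum_ge => j /andP[Pj nji] _.
  have := mini j Pj; rewrite le_eqVlt => /predU1P[/injF ij|]; last lia.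
  by rewrite ij ?eqxx in nji.
have [] := @valD_lt (F i) (\sum_(j | P j && (j != i)) F j) (nF i Pi).
  by case: rest => ?; [left | right; lia].
by rewrite -bigD1 // => ? ?; exists i; split.
Qed.

End Valuation.

Section FractionField.

Variable R : idomainType.

Lemma fraction_ex (u : {fraction R}) :
  exists a b : R, b != 0 /\ u = tofrac a / tofrac b.
Proof.
elim/quotW: u => -[[a b] /= nb]; exists a, b; split=> //.
apply: (canRL (mulfK _)); first by rewrite tofrac_eq0.
unlock tofrac; rewrite -[LHS]FracField.pi_mul; apply/eqmodP.
by rewrite /= FracField.equivfE /FracField.mulf !numden_Ratio ?oner_neq0 ?mulr1 //= mulrC.
Qed.

Lemma fraction_neq0_ex (u : {fraction R}) : u != 0 ->
  exists a b : R, [/\ a != 0, b != 0 & u = tofrac a / tofrac b].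
Proof.
have [a [b [nb ->]]] := fraction_ex u => nab; exists a, b; split=> //.
by apply: contraNneq nab => ->; rewrite tofrac0 mul0r.
Qed.

Lemma fraction_eq (a b a' b' : R) : b != 0 -> b' != 0 ->
  (tofrac a / tofrac b == tofrac a' / tofrac b') = (a * b' == a' * b).
Proof.
by move=> nb nb'; rewrite eqr_div ?tofrac_eq0 // -!tofracM tofrac_eq.
Qed.

Lemma fraction_lift (E : fieldType) (psi : {rmorphism R -> E}) :
  (forall a, a != 0 -> psi a != 0) ->
  exists phi : {rmorphism {fraction R} -> E}, forall a, phi (tofrac a) = psi a.
Proof.
move=> inj_psi.
have /choice [phi phiP] : forall u : {fraction R}, exists e : E,
    forall a b, b != 0 -> u = tofrac a / tofrac b -> e = psi a / psi b.
  move=> u; have [a [b [nb uE]]] := fraction_ex u.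
  exists (psi a / psi b) => a' b' nb' /eqP; rewrite uE fraction_eq // => /eqP ab.
  by apply/eqP; rewrite eqr_div ?inj_psi // -!rmorphM ab.
have phi_frac a b : b != 0 -> phi (tofrac a / tofrac b) = psi a / psi b.
  by move=> nb; apply: phiP.
have phi_zmod : zmod_morphism phi.
  move=> u u'; have [a [b [nb ->]]] := fraction_ex u.
  have [a' [b' [nb' ->]]] := fraction_ex u'.
  rewrite -mulNr addf_div ?tofrac_eq0 // -tofracN -!tofracM -tofracD.
  rewrite !phi_frac ?mulf_neq0 // -mulNr addf_div ?inj_psi //.
  by rewrite -!rmorphN -!rmorphM -rmorphD.
have phi_monoid : monoid_morphism phi.
  split=> [|u u'].
    by rewrite -[1](divr1) -tofrac1 phi_frac ?oner_neq0 // rmorph1 divr1.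
  have [a [b [nb ->]]] := fraction_ex u.
  have [a' [b' [nb' ->]]] := fraction_ex u'.
  rewrite mulf_div -!tofracM !phi_frac ?mulf_neq0 // mulf_div.
  by rewrite -!rmorphM.
pose phiZ := GRing.isZmodMorphism.Build _ _ phi phi_zmod.
pose phiM := GRing.isMonoidMorphism.Build _ _ phi phi_monoid.
pose Phi : {rmorphism {fraction R} -> E} := HB.pack phi phiZ phiM.
exists Phi => a /=.
by rewrite -[tofrac a]divr1 -tofrac1 phi_frac ?oner_neq0 // rmorph1 divr1.
Qed.

Lemma fraction_valuation (w : R -> nat) :
  (forall a b, a != 0 -> b != 0 -> w (a * b) = (w a + w b)%N) ->
  (forall a b, a != 0 -> b != 0 -> a + b != 0 ->
     (minn (w a) (w b) <= w (a + b)%R)%N) ->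
  exists2 v : {fraction R} -> int, is_valuation v &
    forall a, a != 0 -> v (tofrac a) = (w a)%:Z.
Proof.
move=> wM wD.
have /choice [v vP] : forall u : {fraction R}, exists z : int,
    forall a b, a != 0 -> b != 0 -> u = tofrac a / tofrac b ->
      z = (w a)%:Z - (w b)%:Z.
  move=> u; have [->|nu] := eqVneq u 0.
    exists 0 => a b na nb /esym /eqP.
    by rewrite mulf_eq0 invr_eq0 !tofrac_eq0 (negPf na) (negPf nb).
  have [a [b [na nb uE]]] := fraction_neq0_ex nu.
  exists ((w a)%:Z - (w b)%:Z) => a' b' na' nb' /eqP.
  rewrite uE fraction_eq // => /eqP /(congr1 w).
  by rewrite !wM //; lia.
have v_frac a b : a != 0 -> b != 0 ->
    v (tofrac a / tofrac b) = (w a)%:Z - (w b)%:Z.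
  by move=> na nb; apply: vP.
exists v; last first.
  move=> a na; rewrite -[tofrac a]divr1 -tofrac1 v_frac ?oner_neq0 //.
  have := wM 1 1 (oner_neq0 _) (oner_neq0 _); rewrite mulr1; lia.
split=> u u' /fraction_neq0_ex [a [b [na nb ->]]]
  /fraction_neq0_ex [a' [b' [na' nb' ->]]].
  by rewrite mulf_div -!tofracM !v_frac ?mulf_neq0 // !wM //; lia.
rewrite addf_div ?tofrac_eq0 // -!tofracM -tofracD => nD.
have {}nD : a * b' + a' * b != 0.
  by apply: contraNneq nD => ->; rewrite tofrac0 mul0r.
rewrite !v_frac ?mulf_neq0 //.
have := wD (a * b') (a' * b); rewrite !wM //.
move=> /(_ _ _ nD); rewrite !mulf_neq0 // => /(_ isT isT).
move: (w (_ + _)) => k; rewrite ge_min; lia.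
Qed.

End FractionField.

Section KummerExtension.

Variables (F : fieldType) (L : fieldExtType F) (m : nat) (y : L) (f : F).
Hypotheses (m_gt0 : (0 < m)%N) (y_m : y ^+ m = f%:A).
Hypothesis y_gen : <<1; y>>%VS = fullv.

Let ev (p : {poly F}) : L := (map_poly (in_alg L) p).[y].

Let ev_mod p : ev (p %% ('X^m - f%:P)) = ev p.
Proof.
rewrite {2}(divp_eq p ('X^m - f%:P)) /ev rmorphD rmorphM rmorphB /=.
rewrite map_polyXn map_polyC /= hornerD hornerM hornerD hornerN hornerXn hornerC.
by rewrite y_m subrr mulr0 add0r.
Qed.

Let size_mod (p : {poly F}) : (size (p %% ('X^m - f%:P))%R <= m)%N.
Proof.
rewrite -ltnS -(size_XnsubC f m_gt0) ltn_modp.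
by rewrite -size_poly_eq0 size_XnsubC.
Qed.

Let ev_coef (p : {poly F}) : (size p <= m)%N -> ev p = \sum_(i < m) p`_i *: y ^+ i.
Proof.
move=> lepm; rewrite /ev (horner_coef_wide y (n := m)); last first.
  exact: leq_trans (size_poly _ _) lepm.
by apply: eq_bigr => i _; rewrite coef_map /= mulr_algl.
Qed.

Let ev_surj z : exists p, ev p = z.
Proof.
have : z \in <<1; y>>%VS by rewrite y_gen memvf.
case/Fadjoin_polyP => p /polyOver1P [q ->] ->.
by exists q.
Qed.

Lemma kummer_basis z : exists c : 'I_m -> F, z = \sum_(i < m) c i *: y ^+ i.
Proof.
have [p <-] := ev_surj z; exists (fun i => (p %% ('X^m - f%:P))`_i).
by rewrite -ev_mod ev_coef.
Qed.

Hypothesis y_free : forall c : 'I_m -> F,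
  \sum_(i < m) c i *: y ^+ i = 0 -> forall i, c i = 0.

Lemma kummer_lift (E : fieldType) (phi0 : {rmorphism F -> E}) (eta : E) :
  eta ^+ m = phi0 f ->
  exists phi : {rmorphism L -> E}, (forall c, phi c%:A = phi0 c) /\ phi y = eta.
Proof.
move=> eta_m; pose evE (p : {poly F}) : E := (map_poly phi0 p).[eta].
have evED : {morph evE : p q / p + q}.
  by move=> p q; rewrite /evE rmorphD hornerD.
have evEM : {morph evE : p q / p * q}.
  by move=> p q; rewrite /evE rmorphM hornerM.
have evEB : {morph evE : p q / p - q}.
  by move=> p q; rewrite /evE rmorphB hornerD hornerN.
have evB : {morph ev : p q / p - q}.
  by move=> p q; rewrite /ev rmorphB hornerD hornerN.
have evM : {morph ev : p q / p * q}.
  by move=> p q; rewrite /ev rmorphM hornerM.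
have ker p : ev p = 0 -> evE p = 0.
  rewrite -ev_mod ev_coef // => /y_free p0.
  have r0 : p %% ('X^m - f%:P) = 0.
    apply/polyP => i; rewrite coef0; have [ltim|leim] := ltnP i m.
      exact: (p0 (Ordinal ltim)).
    by rewrite nth_default // (leq_trans (size_mod p)).
  rewrite (divp_eq p ('X^m - f%:P)) r0 addr0 evEM {2}/evE rmorphB /=.
  rewrite map_polyXn map_polyC /= hornerD hornerN hornerXn hornerC eta_m subrr.
  by rewrite mulr0.
have [rep repP] := choice ev_surj.
pose phi z := evE (rep z).
have phi_ev p : phi (ev p) = evE p.
  apply/eqP; rewrite -subr_eq0 -evEB; apply/eqP/ker.
  by rewrite evB repP subrr.
have evC c : ev c%:P = c%:A by rewrite /ev map_polyC hornerC.
have phi_zmod : zmod_morphism phi.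
  move=> u u'; have [p <-] := ev_surj u; have [p' <-] := ev_surj u'.
  by rewrite -evB !phi_ev evEB.
have phi_monoid : monoid_morphism phi.
  split=> [|u u'].
    by rewrite -(scale1r 1) -evC phi_ev /evE rmorph1 hornerC.
  have [p <-] := ev_surj u; have [p' <-] := ev_surj u'.
  by rewrite -evM !phi_ev evEM.
pose phiZ := GRing.isZmodMorphism.Build _ _ phi phi_zmod.
pose phiM := GRing.isMonoidMorphism.Build _ _ phi phi_monoid.
pose Phi : {rmorphism L -> E} := HB.pack phi phiZ phiM.
exists Phi; split=> [c|] /=.
  by rewrite -evC phi_ev /evE map_polyC hornerC.
have evX : ev 'X = y by rewrite /ev map_polyX hornerX.
by rewrite -{1}evX phi_ev /evE map_polyX hornerX.
Qed.

End KummerExtension.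

Lemma closed_prim_root (K : closedFieldType) m : (0 < m)%N -> m%:R != 0 :> K ->
  exists w : K, m.-primitive_root w.
Proof.
move=> m_gt0 m_neq0; have [rs rsE] := closed_field_poly_normal ('X^m - 1 : {poly K}).
have lead1 : lead_coef ('X^m - 1 : {poly K}) = 1.
  by apply/eqP; rewrite -monicE monicXnsubC.
rewrite {}lead1 scale1r in rsE.
have /hasP [w _ wP] : has m.-primitive_root rs.
  apply: cyclic.has_prim_root => //.
  - apply/allP => w wrs; by rewrite /root_of_unity rsE root_prod_XsubC.
  - by rewrite -separable_prod_XsubC -rsE separable_Xn_sub_1.
  have := congr1 (fun p : {poly K} => size p) rsE.
  by rewrite size_XnsubC // size_prod_XsubC => -[->].
by exists w.
Qed.

Lemma sum_prim_root (K : fieldType) m (w : K) k : m.-primitive_root w ->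
  \sum_(j < m) (w ^+ k) ^+ j = if (m %| k)%N then m%:R else 0.
Proof.
move=> wP; case: ifP => [mk|nmk].
  have -> : w ^+ k = 1 by apply/eqP; rewrite -(prim_order_dvd wP).
  by under eq_bigr do rewrite expr1n; rewrite sumr_const card_ord.
have : (w ^+ k - 1) * (\sum_(j < m) (w ^+ k) ^+ j) = 0.
  by rewrite -subrX1 -exprM mulnC exprM (prim_expr_order wP) expr1n subrr.
move/eqP; rewrite mulf_eq0 subr_eq0 -(prim_order_dvd wP) nmk.
by move/eqP.
Qed.

Lemma val_normalize (E : fieldType) (v : E -> int) : is_valuation v ->
  (exists2 t, t != 0 & v t != 0) ->
  exists d : nat, [/\ (0 < d)%N, exists2 t, t != 0 & v t = d
    & forall u, u != 0 -> (d %| v u)%Z].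
Proof.
move=> v_val [t0 nt0 vt0].
pose isv n := `[< (0 < n)%N /\ exists2 t, t != 0 & v t = n%:Z >].
have /ex_minnP [d /asboolP [d_gt0 [t nt vt]] mind] : exists n, isv n.
  exists `|v t0|%N; apply/asboolP; split; first lia.
  have [vpos|vneg] := leP 0 (v t0); first by exists t0; lia.
  by exists t0^-1; rewrite ?invr_neq0 // valV //; lia.
exists d; split=> // [|u nu]; first by exists t.
have v_texp (k : int) : v (t ^ k) = k * v t.
  case: k => n; first by rewrite -exprnP val_exp.
  by rewrite /= valV ?expf_neq0 // val_exp // NegzE; lia.
have nw : u * t ^ (- (v u %/ d)%Z) != 0 by rewrite mulf_neq0 ?expfz_neq0.
have vw : v (u * t ^ (- (v u %/ d)%Z)) = (v u %% d)%Z.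
  by rewrite valM ?expfz_neq0 // v_texp vt /modz; lia.
apply/dvdz_mod0P; apply: contrapT => nr.
have r_ge0 : 0 <= (v u %% d)%Z by rewrite modz_ge0; lia.
have r_ltd : (v u %% d)%Z < d by rewrite ltz_pmod; lia.
case: (v u %% d)%Z vw nr r_ge0 r_ltd => [n|//] vw nr _ r_ltd.
suff /mind : isv n by lia.
by apply/asboolP; split; [lia | exists (u * t ^ (- (v u %/ d)%Z))].
Qed.

Section Places.

Variables (K : fieldType) (L : fieldExtType (ratfun K)).

Lemma place_valuation (P : place L) : is_valuation P.
Proof. by split; [apply: ord_atM | apply: ord_atD]. Qed.

Lemma valuation_place (v : L -> int) : is_valuation v ->
  (forall c, c != 0 -> v (ff_const L c) = 0) ->
  (exists2 t, t != 0 & v t != 0) ->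
  exists (P : place L) (d : nat),
    (0 < d)%N /\ forall u, u != 0 -> v u = ord_at P u * d%:Z.
Proof.
move=> v_val vC vt; have [d [d_gt0 [t nt vtd] dv]] := val_normalize v_val vt.
pose o u : int := if u == 0 then 0 else (v u %/ d)%Z.
have oE u : u != 0 -> v u = o u * d%:Z.
  by move=> nu; rewrite /o (negPf nu) divzK ?dv.
have o0 : o 0 = 0 by rewrite /o eqxx.
have oM u w : u != 0 -> w != 0 -> o (u * w) = o u + o w.
  move=> nu nw; apply: (mulIf (x := d%:Z)); first by rewrite eqz_nat -lt0n.
  by rewrite mulrDl -!oE ?mulf_neq0 // valM.
have oD u w : u != 0 -> w != 0 -> u + w != 0 -> Num.min (o u) (o w) <= o (u + w).
  move=> nu nw nuw; have := v_val.2 u w nu nw nuw.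
  by rewrite !oE // !ge_min !ler_pM2r.
have oC c : c != 0 -> o (ff_const L c) = 0.
  move=> nc; have := vC c nc; rewrite oE => [/eqP|].
    by rewrite mulf_eq0 eqz_nat (gtn_eqF d_gt0) orbF => /eqP.
  by rewrite scaler_eq0 oner_eq0 orbF tofrac_eq0 polyC_eq0.
have ot : exists2 t, t != 0 & o t = 1.
  exists t => //; have /eqP := oE t nt; rewrite vtd -{1}[d%:Z]mul1r.
  by rewrite (inj_eq (mulIf _)) ?eqz_nat -?lt0n // eq_sym => /eqP.
by exists (Place o0 oM oD oC ot), d.
Qed.

End Places.

Lemma mup_factor (K : fieldType) (x : K) (a : {poly K}) : a != 0 ->
  exists2 a0, a = ('X - x%:P) ^+ mup x a * a0 & a0.[x] != 0.
Proof.
move=> na; have := mup_geq x (mup x a) na; rewrite leqnn => /esym /dvdpP [a0 a0E].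
exists a0; first by rewrite mulrC.
apply/negP => a0x; have := mup_leq x (mup x a) na; rewrite leqnn => /esym/negP; apply.
have /factor_theorem [b bE] : root a0 x by [].
by rewrite {2}a0E bE -mulrA -exprS dvdp_mull.
Qed.

Section LocalField.

Variables (K : closedFieldType) (m : nat) (alpha : K).
Hypotheses (m_gt0 : (0 < m)%N) (m_neq0 : m%:R != 0 :> K).

Lemma local_field (f : {poly K}) : f != 0 ->
  exists (E : fieldType) (v : E -> int) (phi : {rmorphism ratfun K -> E}) (eta : E),
  [/\ is_valuation v, eta ^+ m = phi (tofrac f)
    & forall a, a != 0 -> v (phi (tofrac a)) = (m * mup alpha a)%N].
Proof.
move=> nf; pose q : {poly K} := 'X^m + alpha%:P.
have size_q : (1 < size q)%N.
  by rewrite /q -[alpha]opprK polyCN size_XnsubC.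
pose psi : {rmorphism {poly K} -> pseries K} := @ps_poly K \o comp_poly q.
have psi_eq0 a : (psi a == 0) = (a == 0).
  by rewrite /= ps_poly_eq0 comp_poly_eq0.
have psi_factor k a : psi (('X - alpha%:P) ^+ k * a) = ps_poly ('X^(m * k) * (a \Po q)).
  rewrite /= rmorphM rmorphXn /= rmorphB /= comp_polyX comp_polyC /q addrK.
  by rewrite exprM.
have comp_q0 a : (a \Po q)`_0 = a.[alpha].
  by rewrite -horner_coef0 horner_comp hornerD hornerXn expr0n gtn_eqF // hornerC add0r.
have psi_ord a : a != 0 -> ps_ord (psi a) = (m * mup alpha a)%N.
  move=> na; have [a0 aE a0x] := mup_factor alpha na.
  by rewrite {1}aE psi_factor ps_ord_polyXn // comp_q0.
pose psiF : {rmorphism {poly K} -> {fraction pseries K}} := @tofrac _ \o psi.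
have inj_psiF a : a != 0 -> psiF a != 0 by rewrite tofrac_eq0 psi_eq0.
have [phi phiP] := fraction_lift inj_psiF.
have [v v_val vE] := fraction_valuation (@ps_ordM K) (@ps_ordD K).
have [a0 fE a0x] := mup_factor alpha nf.
have [h hm _] : exists2 h, h ^+ m = ps_poly (a0 \Po q) & pcoef h 0 != 0.
  by apply: ps_root => //; rewrite comp_q0.
exists {fraction pseries K}, v, phi, (tofrac (ps_poly 'X^(mup alpha f) * h)).
split=> // [|a na].
  rewrite phiP -tofracXn exprMn hm -rmorphXn -rmorphM -exprM mulnC /=.
  by rewrite -psi_factor -fE.
by rewrite phiP vE ?psi_eq0 // psi_ord.
Qed.

Variables (L : fieldExtType (ratfun K)) (y : L) (f : {poly K}).
Hypotheses (nf : f != 0) (y_m : y ^+ m = (tofrac f : ratfun K)%:A).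
Hypothesis y_gen : <<1; y>>%VS = fullv.
Hypothesis y_free : forall c : 'I_m -> ratfun K,
  \sum_(i < m) c i *: y ^+ i = 0 -> forall i, c i = 0.

(* Averaging over the m-th roots of unity isolates each term of [z]: the places
   [y |-> w ^+ j * eta] carry the same valuation of [E]. *)
Lemma regular_coef (c : 'I_m -> ratfun K) (i : 'I_m) (a b : {poly K}) :
  (forall P : place L, 0 <= ord_at P (ff_x L) ->
     0 <= ord_at P (\sum_(k < m) c k *: y ^+ k)) ->
  a != 0 -> b != 0 -> c i = tofrac a / tofrac b ->
  (m * mup alpha b <= m * mup alpha a + i * mup alpha f)%N.
Proof.
set z := \sum_(k < m) _ => regz na nb ciE.
have [E [v [phi [eta [v_val eta_m vE]]]]] := local_field nf.
have [w wP] := closed_prim_root m_gt0 m_neq0.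
pose kap : {rmorphism K -> E} := phi \o (@tofrac _ \o polyC).
have kap_neq0 u : u != 0 -> kap u != 0.
  by move=> nu; rewrite fmorph_eq0.
have v_kap u : u != 0 -> v (kap u) = 0.
  by move=> nu; rewrite /= vE ?polyC_eq0 // mupNroot ?muln0 // rootC.
have w_neq0 : w != 0.
  apply/eqP => w0; have /eqP := prim_expr_order wP.
  by rewrite w0 expr0n gtn_eqF // eq_sym oner_eq0.
have neta : eta != 0.
  apply/eqP => eta0; have /eqP := eta_m.
  by rewrite eta0 expr0n gtn_eqF // eq_sym fmorph_eq0 tofrac_eq0 (negPf nf).
have term j : exists2 e, e = \sum_(k < m) phi (c k) * (kap (w ^+ j) * eta) ^+ k
    & e = 0 \/ 0 <= v e.
  exists (\sum_(k < m) phi (c k) * (kap (w ^+ j) * eta) ^+ k) => //.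
  have [|Phi [PhiC Phiy]] := @kummer_lift _ L m y (tofrac f) m_gt0 y_m y_gen y_free
    E phi (kap (w ^+ j) * eta).
    rewrite exprMn eta_m /kap -!rmorphXn -exprM mulnC exprM.
    by rewrite (prim_expr_order wP) expr1n !rmorph1 mul1r.
  have Phiz : Phi z = \sum_(k < m) phi (c k) * (kap (w ^+ j) * eta) ^+ k.
    rewrite rmorph_sum; apply: eq_bigr => k _.
    by rewrite -mulr_algl rmorphM /= PhiC rmorphXn /= Phiy.
  rewrite -Phiz; have [->|nz] := eqVneq z 0; [by left; rewrite rmorph0 | right].
  have vPhi : is_valuation (fun u => v (Phi u)).
    split=> u u' nu nu'; first by rewrite rmorphM (valM v_val) ?fmorph_eq0.
    by rewrite rmorphD => nD; apply: v_val.2; rewrite -?rmorphD fmorph_eq0.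
  have [] := valuation_place vPhi.
  - by move=> u nu; rewrite PhiC v_kap.
  - exists (tofrac ('X - alpha%:P) : ratfun K)%:A.
      by rewrite scaler_eq0 oner_eq0 orbF tofrac_eq0 polyXsubC_eq0.
    rewrite PhiC vE ?polyXsubC_eq0 // -['X - _]expr1 mup_XsubCX eqxx.
    by rewrite muln1; lia.
  move=> P [d [d_gt0 PE]]; rewrite PE //.
  rewrite mulr_ge0 // regz //.
  have nx : ff_x L != 0.
    by rewrite scaler_eq0 oner_eq0 orbF tofrac_eq0 polyX_eq0.
  rewrite -(@pmulr_lge0 _ d%:Z) //.
  by rewrite -PE // PhiC vE // polyX_eq0.
have sumE : \sum_(j < m) kap (w ^+ (j * (m - i))) *
    (\sum_(k < m) phi (c k) * (kap (w ^+ j) * eta) ^+ k) =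
    kap m%:R * (phi (c i) * eta ^+ i).
  under eq_bigr do rewrite mulr_sumr.
  have avg k : \sum_(j < m) kap (w ^+ (j * (m - i))) *
      (phi (c k) * (kap (w ^+ j) * eta) ^+ k) =
      kap (if k == i then m%:R else 0) * (phi (c k) * eta ^+ k).
    have -> : (k == i) = (m %| m - i + k)%N.
      have := ltn_ord i; have := ltn_ord k => ltk lti.
      rewrite -val_eqE /=; apply/eqP/idP => [->|]; first by rewrite subnK ?dvdnn // ltnW.
      case/dvdnP => -[|[|n]]; nia.
    rewrite -(sum_prim_root _ wP) rmorph_sum mulr_suml; apply: eq_bigr => j _.
    rewrite -exprM mulnDl exprD rmorphM exprMn -(rmorphXn kap) -exprM.
    rewrite (mulnC j) (mulnC j k); move: (kap _) (kap _) => u u'.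
    by ring.
  rewrite exchange_big /= (eq_bigr _ (fun k _ => avg k)).
  rewrite (bigD1 i) //= eqxx big1 ?addr0 // => k /negPf ->.
  by rewrite rmorph0 mul0r.
have phic : phi (c i) = phi (tofrac a) / phi (tofrac b).
  by rewrite ciE rmorphM fmorphV.
have nphi p : p != 0 -> phi (tofrac p) != 0 by rewrite fmorph_eq0 tofrac_eq0.
have nphic : phi (c i) != 0 by rewrite phic mulf_neq0 ?invr_eq0 ?nphi.
have : 0 <= v (phi (c i) * eta ^+ i).
  have : 0 <= v (kap m%:R * (phi (c i) * eta ^+ i)).
    rewrite -sumE; have [|e0|//] := @val_sum_ge _ _ v_val 'I_m predT (fun j : 'I_m =>
        kap (w ^+ (j * (m - i))) *
        (\sum_(k < m) phi (c k) * (kap (w ^+ j) * eta) ^+ k)) 0.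
      move=> j _; rewrite mulf_eq0 => /norP [n1 n2].
      rewrite (valM v_val) // v_kap ?expf_neq0 // add0r.
      have [e eE [e0|]] := term j; last by rewrite eE.
      by rewrite -eE e0 eqxx in n2.
    move: e0; rewrite sumE => /eqP; rewrite !mulf_eq0 (negPf (kap_neq0 _ _)) //.
    by rewrite (negPf nphic) expf_eq0 (negPf neta) andbF.
  by rewrite (valM v_val) ?kap_neq0 ?mulf_neq0 ?expf_neq0 // v_kap // add0r.
have : m%:Z * v eta = (m * mup alpha f)%N by rewrite -(val_exp v_val) // eta_m vE.
rewrite (valM v_val) ?expf_neq0 // (val_exp v_val) // phic.
rewrite (valM v_val) ?invr_eq0 ?nphi // (valV v_val) ?nphi // !vE //.
have : (0 < m%:Z) by []; move: (mup _ _) (mup _ _) (mup _ _) (v eta) => A B C V.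
nia.
Qed.

End LocalField.

(** * Places of the curve *)

Lemma size_le_mup (K : closedFieldType) (a b : {poly K}) : a != 0 -> b != 0 ->
  (forall x, (mup x b <= mup x a)%N) -> (size b <= size a)%N.
Proof.
move: {2}(size b) (leqnn (size b)) => n.
elim: n a b => [|n IHn] a b.
  by rewrite leqn0 size_poly_eq0 => /eqP -> _; rewrite eqxx.
move=> leb na nb ab; have [sb1|/closed_rootP [x /factor_theorem [b' bE]]] := eqVneq (size b) 1.
  by rewrite sb1 lt0n size_poly_eq0.
have nb' : b' != 0 by apply: contraNneq nb => b'0; rewrite bE b'0 mul0r.
have nX y : 'X - y%:P != 0 :> {poly K} by rewrite polyXsubC_eq0.
have mupX y : mup y ('X - x%:P) = (x == y)%N.
  by rewrite -['X - _]expr1 mup_XsubCX; case: eqP.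
have /factor_theorem [a' aE] : root a x.
  rewrite -dvdp_XsubCl XsubC_dvd //; apply: leq_trans (ab x).
  by rewrite bE mupM // mupX eqxx addn1.
have na' : a' != 0 by apply: contraNneq na => a'0; rewrite aE a'0 mul0r.
rewrite aE bE !size_mul // !size_XsubC !addn2 /= ltnS IHn //.
  by move: leb; rewrite bE size_mul // size_XsubC addn2.
by move=> y; have := ab y; rewrite aE bE !mupM // leq_add2r.
Qed.

Section ProductXsubC.

Variables (K : fieldType) (r : nat) (alpha : 'I_r -> K) (e : 'I_r -> nat).

Lemma prodX_neq0 : \prod_(i < r) ('X - (alpha i)%:P) ^+ e i != 0.
Proof. by apply/prodf_neq0 => i _; rewrite expf_neq0 ?polyXsubC_eq0. Qed.

Lemma size_prodX :
  (size (\prod_(i < r) ('X - (alpha i)%:P) ^+ e i)).-1 = (\sum_(i < r) e i)%N.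
Proof.
rewrite size_prod => [|i _]; last by rewrite expf_neq0 ?polyXsubC_eq0.
rewrite (eq_bigr (fun i => e i + 1)%N) => [|i _].
  by rewrite big_split /= sum_nat_const muln1 subSKn addnK.
by rewrite size_exp_XsubC addn1.
Qed.

Lemma mup_prodX x : injective alpha ->
  mup x (\prod_(i < r) ('X - (alpha i)%:P) ^+ e i) =
  if [pick k | alpha k == x] is Some k then e k else 0%N.
Proof.
move=> alpha_inj.
have nX (i : 'I_r) : ('X - (alpha i)%:P) ^+ e i != 0.
  by rewrite expf_neq0 ?polyXsubC_eq0.
have [_ ->] : \prod_(i < r) ('X - (alpha i)%:P) ^+ e i != 0 /\
  mup x (\prod_(i < r) ('X - (alpha i)%:P) ^+ e i) =
    (\sum_(i < r) if alpha i == x then e i else 0)%N.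
  elim/big_rec2: _ => [|i k p _ [np IH]].
    by rewrite oner_neq0 mupNroot // root1.
  by rewrite mulf_neq0 // mupM // IH mup_XsubCX.
case: pickP => [k /eqP kx|nx]; last by rewrite big1 // => i _; rewrite nx.
rewrite (bigD1 k) //= kx eqxx big1 ?addn0 // => i nik.
by rewrite -kx (inj_eq alpha_inj) (negPf nik).
Qed.

End ProductXsubC.

Lemma coprime_key_inj (m l e i j : nat) (a b : int) : (0 < e)%N -> coprime m l ->
  (i < m)%N -> (j < m)%N ->
  a * (m * e)%N%:Z + i%:Z * (l * e)%N%:Z = b * (m * e)%N%:Z + j%:Z * (l * e)%N%:Z ->
  i = j.
Proof.
move=> e_gt0 co_ml ltim ltjm ab.
have {}ab : m%:Z * (b - a) = (i%:Z - j%:Z) * l%:Z.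
  have ne : e%:Z != 0 by rewrite eqz_nat -lt0n.
  apply: (mulIf ne); apply/eqP; rewrite -subr_eq0; apply/eqP.
  move/eqP: ab; rewrite -subr_eq0 => /eqP ab.
  by rewrite -[RHS]oppr0 -[in RHS]ab !PoszM; ring.
have : (m%:Z %| (i%:Z - j%:Z) * l%:Z)%Z by rewrite -ab dvdz_mulr.
rewrite Gauss_dvdzl // -eqz_mod_dvd !modz_small ?ltz_nat //.
by rewrite eqz_nat => /eqP.
Qed.

Section CurvePlaces.

Variables (K : closedFieldType) (m r : nat).
Hypotheses (m_gt1 : (2 <= m)%N) (m_neq0 : m%:R != 0 :> K).
Variables (alpha : 'I_r -> K) (lam : 'I_r -> nat).
Hypotheses (alpha_inj : injective alpha) (m_coprime : coprime m (lambda0 lam)).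
Variables (L : fieldExtType (ratfun K)) (y : L).
Hypothesis y_m : y ^+ m = \prod_(i < r) (ff_x L - ff_const L (alpha i)) ^+ lam i.
Hypothesis y_gen : <<1; y>>%VS = fullv.

Let m_gt0 : (0 < m)%N. Proof. exact: ltnW. Qed.

Let emb (a : {poly K}) : L := (tofrac a : ratfun K)%:A.

Lemma emb_eq0 a : (emb a == 0) = (a == 0).
Proof. by rewrite scaler_eq0 oner_eq0 orbF tofrac_eq0. Qed.

Lemma embM a b : emb (a * b) = emb a * emb b.
Proof. by rewrite /emb tofracM -[LHS]/(in_alg L _) rmorphM. Qed.

Lemma embD a b : emb (a + b) = emb a + emb b.
Proof. by rewrite /emb tofracD -[LHS]/(in_alg L _) rmorphD. Qed.

Lemma emb_XsubC c : emb ('X - c%:P) = ff_x L - ff_const L c.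
Proof. by rewrite /emb tofracB -[LHS]/(in_alg L _) rmorphB. Qed.

Lemma emb_prodX e :
  emb (\prod_(i < r) ('X - (alpha i)%:P) ^+ e i) =
  \prod_(i < r) (ff_x L - ff_const L (alpha i)) ^+ e i.
Proof.
rewrite /emb -[LHS]/((in_alg L \o @tofrac _) _) rmorph_prod.
by apply: eq_bigr => i _; rewrite rmorphXn /= -[_ *: 1]/(emb _) emb_XsubC.
Qed.

Lemma y_m_emb :
  y ^+ m = (tofrac (\prod_(i < r) ('X - (alpha i)%:P) ^+ lam i) : ratfun K)%:A.
Proof. by rewrite y_m -emb_prodX. Qed.

Lemma y_neq0 : y != 0.
Proof.
have : y ^+ m != 0 by rewrite y_m_emb -[_%:A]/(emb _) emb_eq0 prodX_neq0.
by rewrite expf_eq0 m_gt0.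
Qed.

Lemma ff_x_neq0 : ff_x L != 0.
Proof. by rewrite -[ff_x L]/(emb _) emb_eq0 polyX_eq0. Qed.

Lemma xsubc_neq0 c : ff_x L - ff_const L c != 0.
Proof. by rewrite -emb_XsubC emb_eq0 polyXsubC_eq0. Qed.

Lemma scale_eq0 c n : (c *: y ^+ n == 0) = (c == 0).
Proof. by rewrite scaler_eq0 expf_eq0 (negPf y_neq0) andbF orbF. Qed.

Lemma ord_at_y (P : place L) :
  m%:Z * ord_at P y = \sum_(i < r) (lam i)%:Z * ord_at P (ff_x L - ff_const L (alpha i)).
Proof.
rewrite -(val_exp (place_valuation P)) ?y_neq0 // y_m.
rewrite (val_prod (place_valuation P)) => [|i].
  by apply: eq_bigr => i _; rewrite (val_exp (place_valuation P)) ?xsubc_neq0.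
by rewrite expf_neq0 ?xsubc_neq0.
Qed.

Lemma kummer_expansion z : z != 0 -> exists c : 'I_m -> ratfun K,
  z = \sum_(k < m) c k *: y ^+ k /\ exists i, c i != 0.
Proof.
move=> nz; have [c zE] := kummer_basis m_gt0 y_m_emb y_gen z.
exists c; split=> //; apply/existsP; apply: contraNT nz.
rewrite negb_exists => /forallP c0; rewrite zE big1 // => i _.
by have := c0 i; rewrite negbK => /eqP ->; rewrite scale0r.
Qed.

Section AtInfinity.

Variable P : place L.
Hypothesis P_inf : ord_at P (ff_x L) < 0.

Let P_val := place_valuation P.

Lemma ord_inf_poly a : a != 0 ->
  ord_at P (emb a) = (size a).-1%:Z * ord_at P (ff_x L).
Proof.
elim/poly_ind: a => [|a c IHa]; first by rewrite eqxx.
have [->|na _] := eqVneq a 0.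
  rewrite mul0r add0r polyC_eq0 => nc.
  by rewrite -[emb _]/(ff_const L c) ord_at_const // size_polyC nc mul0r.
rewrite embD embM -[emb 'X]/(ff_x L) size_MXaddC (negPf na) /=.
have nax : emb a * ff_x L != 0 by rewrite mulf_neq0 ?ff_x_neq0 ?emb_eq0.
have sa : (0 < size a)%N by rewrite lt0n size_poly_eq0.
have vax : ord_at P (emb a * ff_x L) = (size a)%:Z * ord_at P (ff_x L).
  rewrite (valM P_val) ?ff_x_neq0 ?emb_eq0 // IHa //.
  by rewrite -{2}(prednK sa); lia.
have [|_ ->//] := valD_lt P_val (w := emb c%:P) nax.
have [->|nc] := eqVneq c 0; [left | right].
  by apply/eqP; rewrite emb_eq0.
by rewrite vax -[emb c%:P]/(ff_const L c) ord_at_const //; nia.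
Qed.

Lemma ord_inf_ex : exists e : nat,
  [/\ (0 < e)%N, ord_at P (ff_x L) = - (m * e)%N%:Z
    & ord_at P y = - (lambda0 lam * e)%N%:Z].
Proof.
have := ord_at_y P; under eq_bigr do
  rewrite -emb_XsubC ord_inf_poly ?polyXsubC_eq0 // size_XsubC mul1r.
rewrite -mulr_suml -(big_morph Posz PoszD (erefl 0%:Z)) -[(\sum_(i < r) _)%N]/(lambda0 lam).
case xE: (ord_at P (ff_x L)) P_inf => [|n] // _; rewrite NegzE => yE.
have /dvdnP [e eE] : (m %| n.+1)%N.
  rewrite -(Gauss_dvdr _ m_coprime); apply/dvdnP; exists `|ord_at P y|%N; lia.
exists e; split; [lia | by rewrite eE mulnC |].
have : m%:Z * (ord_at P y + (lambda0 lam * e)%N%:Z) = 0 by rewrite mulrDr yE eE; lia.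
by move/eqP; rewrite mulf_eq0; lia.
Qed.

Lemma ord_inf_term a b (k : nat) : a != 0 -> b != 0 ->
  ord_at P ((tofrac a / tofrac b) *: y ^+ k) =
    ((size a).-1%:Z - (size b).-1%:Z) * ord_at P (ff_x L) + k%:Z * ord_at P y.
Proof.
move=> na nb.
have -> : (tofrac a / tofrac b) *: y ^+ k = emb a / emb b * y ^+ k.
  by rewrite -mulr_algl -[_%:A]/(in_alg L _) rmorphM fmorphV.
have nea : emb a != 0 by rewrite emb_eq0.
have neb : emb b != 0 by rewrite emb_eq0.
rewrite (valM P_val) ?mulf_neq0 ?invr_eq0 ?expf_neq0 ?y_neq0 //.
rewrite (valM P_val) ?invr_eq0 // (valV P_val) // (val_exp P_val) ?y_neq0 //.
by rewrite (ord_inf_poly na) (ord_inf_poly nb) mulrBl.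
Qed.

Lemma ord_inf_sum (c : 'I_m -> ratfun K) i0 : c i0 != 0 ->
  exists i, [/\ c i != 0, \sum_(k < m) c k *: y ^+ k != 0,
    ord_at P (\sum_(k < m) c k *: y ^+ k) = ord_at P (c i *: y ^+ i)
    & forall k, c k != 0 -> ord_at P (c i *: y ^+ i) <= ord_at P (c k *: y ^+ k)].
Proof.
move=> ci0; have sumE : \sum_(k < m) c k *: y ^+ k = \sum_(k < m | c k != 0) c k *: y ^+ k.
  rewrite (bigID (fun k => c k == 0)) /= big1 ?add0r // => k /eqP ->.
  by rewrite scale0r.
rewrite sumE; apply: (@val_sum_distinct _ _ P_val _ (fun k => c k != 0)
  (fun k : 'I_m => c k *: y ^+ k) i0 ci0) => [k ck|k l].
  by rewrite scale_eq0.
move=> /fraction_neq0_ex [a [b [na nb ->]]] /fraction_neq0_ex [a' [b' [na' nb' ->]]].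
rewrite (ord_inf_term k na nb) (ord_inf_term l na' nb').
have [e [e_gt0 -> ->]] := ord_inf_ex.
move=> /(congr1 -%R); rewrite !mulrN -!opprD !opprK => AB.
exact: val_inj (coprime_key_inj e_gt0 m_coprime (ltn_ord k) (ltn_ord l) AB).
Qed.

Lemma ord_inf : ord_at P (ff_x L) = - m%:Z /\ ord_at P y = - (lambda0 lam)%:Z.
Proof.
have [e [e_gt0 ordx ordy]] := ord_inf_ex.
suff e1 : e = 1%N by rewrite ordx ordy e1 !muln1.
have [t nt t1] := ord_at_unif P; have [c [tE [i0 ci0]]] := kummer_expansion nt.
have [i [/fraction_neq0_ex [a [b [na nb ciE]]] _ ordt _]] := ord_inf_sum ci0.
move: ordt; rewrite -tE t1 ciE (ord_inf_term i na nb) ordx ordy => e1.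
have : (e%:Z %| 1)%Z.
  move: (_ - _) e1 => A e1; apply/dvdzP; exists (- (A * m%:Z + i%:Z * (lambda0 lam)%:Z)).
  by apply: (etrans e1); rewrite !PoszM; ring.
by rewrite dvdz1 => /eqP.
Qed.

End AtInfinity.

Variable Q : place L.
Hypothesis Q_inf : ord_at Q (ff_x L) < 0.

Lemma kummer_free (c : 'I_m -> ratfun K) :
  \sum_(i < m) c i *: y ^+ i = 0 -> forall i, c i = 0.
Proof.
move=> c0 i; apply/eqP; apply: contra_eqT c0 => ci.
by have [j [_ + _ _]] := ord_inf_sum Q_inf ci.
Qed.

Lemma inf_place_unique (P : place L) : ord_at P (ff_x L) < 0 -> same_place P Q.
Proof.
move=> P_inf u; have [->|nu] := eqVneq u 0; first by rewrite !ord_at0.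
have [c [uE [i0 ci0]]] := kummer_expansion nu.
have PQ i : c i != 0 -> ord_at P (c i *: y ^+ i) = ord_at Q (c i *: y ^+ i).
  case/fraction_neq0_ex => a [b [na nb ->]].
  rewrite (ord_inf_term P_inf i na nb) (ord_inf_term Q_inf i na nb).
  by have [-> ->] := ord_inf P_inf; have [-> ->] := ord_inf Q_inf.
have [i [ci _ ordP mini]] := ord_inf_sum P_inf ci0.
have [j [cj _ ordQ minj]] := ord_inf_sum Q_inf ci0.
rewrite uE ordP ordQ; apply/eqP; rewrite eq_le; apply/andP; split.
  by rewrite -(PQ j cj); apply: mini.
by rewrite (PQ i ci); apply: minj.
Qed.

Lemma ord_off_infinity (P : place L) : ~ same_place P Q -> 0 <= ord_at P (ff_x L).
Proof. by move=> nPQ; rewrite leNgt; apply/negP => /inf_place_unique. Qed.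

Lemma floor_sum j :
  (\sum_(i < r) (j * lam i %% m) + m * \sum_(i < r) (j * lam i %/ m) =
   j * lambda0 lam)%N.
Proof.
rewrite /lambda0 !big_distrr -big_split; apply: eq_bigr => i _ /=.
by rewrite addnC mulnC -divn_eq.
Qed.

Lemma semigroup_mem j a :
  weierstrass_semigroup Q (m * a + \sum_(i < r) (j * lam i %% m)).
Proof.
pose d i := (j * lam i %/ m)%N.
pose D := emb (\prod_(i < r) ('X - (alpha i)%:P) ^+ d i).
have nD : D != 0 by rewrite emb_eq0 prodX_neq0.
have nx := ff_x_neq0; have ny := y_neq0.
pose z := ff_x L ^+ a * y ^+ j / D.
have nz : z != 0 by rewrite !mulf_neq0 ?invr_eq0 ?expf_neq0.
have ordz (P : place L) :
    ord_at P z = a%:Z * ord_at P (ff_x L) + j%:Z * ord_at P y - ord_at P D.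
  have P_val := place_valuation P.
  rewrite (valM P_val) ?mulf_neq0 ?invr_eq0 ?expf_neq0 // (valV P_val) //.
  by rewrite (valM P_val) ?expf_neq0 // !(val_exp P_val).
exists z; split=> // [|P /ord_off_infinity x_ge0].
  rewrite /pole_order ordz (ord_inf_poly Q_inf (prodX_neq0 alpha d)) size_prodX.
  have [-> ->] := ord_inf Q_inf; have := floor_sum j; rewrite -/(d _).
  set F := (\sum_(i < r) d i)%N; set R := (\sum_(i < r) _)%N => RF.
  rewrite (_ : - _ = (m * a + R)%N%:Z) ?max_r //.
  by move/(congr1 Posz): RF; rewrite !PoszD !PoszM => RF; lia.
apply: max_l; rewrite oppr_le0 -(pmulr_rge0 _ (x := m%:Z)) // ordz.
have P_val := place_valuation P.
have xc_ge0 c : 0 <= ord_at P (ff_x L - ff_const L c).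
  have [->|nc] := eqVneq c 0.
    by rewrite -emb_XsubC subr0.
  have nec : ff_const L (- c) != 0.
    by rewrite -[ff_const _ _]/(emb _) emb_eq0 polyC_eq0 oppr_eq0.
  have <- : ff_x L + ff_const L (- c) = ff_x L - ff_const L c.
    by rewrite -emb_XsubC -polyCN embD.
  apply: (valD P_val) => //; last by rewrite ord_at_const ?oppr_eq0.
  by rewrite -[ff_x L]/(emb 'X) -embD emb_eq0 polyCN polyXsubC_eq0.
have ordD : ord_at P D = \sum_(i < r) (d i)%:Z * ord_at P (ff_x L - ff_const L (alpha i)).
  rewrite /D emb_prodX (val_prod P_val) => [|i]; last by rewrite expf_neq0 ?xsubc_neq0.
  by apply: eq_bigr => i _; rewrite (val_exp P_val) ?xsubc_neq0.
have -> : m%:Z * (a%:Z * ord_at P (ff_x L) + j%:Z * ord_at P y - ord_at P D) =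
    m%:Z * a%:Z * ord_at P (ff_x L) + (j%:Z * (m%:Z * ord_at P y) - m%:Z * ord_at P D).
  by ring.
rewrite addr_ge0 ?mulr_ge0 // ord_at_y ordD !mulr_sumr -sumrB sumr_ge0 // => i _.
rewrite !mulrA -mulrBl mulr_ge0 // subr_ge0 -!PoszM lez_nat mulnC.
exact: leq_divM.
Qed.

Lemma semigroup_sub s : weierstrass_semigroup Q s ->
  exists j a, (j < m)%N /\ s = (m * a + \sum_(i < r) (j * lam i %% m))%N.
Proof.
case=> z [nz ordz regz].
have [c [zE [i0 ci0]]] := kummer_expansion nz.
have [i [/fraction_neq0_ex [a [b [na nb ciE]]] _ ordzi _]] := ord_inf_sum Q_inf ci0.
pose d k := (i * lam k %/ m)%N.
pose D := \prod_(k < r) ('X - (alpha k)%:P) ^+ d k.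
have nf := prodX_neq0 alpha lam.
have le_b : ((size b).-1 <= (size a).-1 + \sum_(k < r) d k)%N.
  rewrite -(size_prodX alpha) -/D.
  have nD : D != 0 by apply: prodX_neq0.
  have : (size b <= size (a * D)%R)%N.
    apply: size_le_mup => // [|x]; first by rewrite mulf_neq0.
    have regP (P : place L) : 0 <= ord_at P (ff_x L) ->
        0 <= ord_at P (\sum_(k < m) c k *: y ^+ k).
      move=> x_ge0; have nPQ : ~ same_place P Q.
        by move=> PQ; move: x_ge0; rewrite PQ leNgt Q_inf.
      by have := regz P nPQ; rewrite -zE /pole_order; case: leP; lia.
    have := @regular_coef K m x m_gt0 m_neq0 L y _ nf y_m_emb y_gen kummer_free
      c i a b regP na nb ciE.
    rewrite mupM // !mup_prodX //; move: (mup x a) (mup x b) => A B.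
    case: pickP => [k _|_]; last by rewrite muln0 !addn0 leq_pmul2l.
    rewrite -leq_subLR -mulnBr mulnC => le_f; rewrite -leq_subLR.
    by rewrite /d leq_divRL.
  have nsz (p : {poly K}) : p != 0 -> size p = (size p).-1.+1.
    by move=> np; rewrite prednK // lt0n size_poly_eq0.
  by rewrite size_mul // (nsz a na) (nsz D nD) (nsz b nb) /= addnS.
have [ordx ordy] := ord_inf Q_inf.
move: ordzi; rewrite -zE ciE (ord_inf_term Q_inf i na nb) ordx ordy => ordzQ.
exists i, ((size a).-1 + \sum_(k < r) d k - (size b).-1)%N; split=> //.
have := floor_sum i; move: ordz; rewrite /pole_order ordzQ -/(d _).
move: le_b; move: (size a).-1 (size b).-1 (\sum_(k < r) d k)%N => A B D' le_b.
move: (\sum_(k < r) _)%N => R sE RE; apply/eqP; rewrite -eqz_nat -sE.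
have -> : - ((A%:Z - B%:Z) * - m%:Z + i%:Z * - (lambda0 lam)%:Z) =
    (m * (A + D' - B) + R)%N%:Z.
  rewrite PoszD PoszM -subzn // PoszD.
  have {}RE : i%:Z * (lambda0 lam)%:Z = R%:Z + m%:Z * D'%:Z.
    by rewrite -!PoszM -PoszD RE.
  by rewrite !mulrN -opprD opprK RE; ring.
by rewrite max_r.
Qed.

End CurvePlaces.

Unset Implicit Arguments.

Theorem proposition4p6
  (p e : nat) (hp : prime p) (he : (0 < e)%N)
  (Fq : finFieldType) (hq : #|Fq| = (p ^ e)%N)
  (* K is an algebraic closure of Fq *)
  (K : closedFieldType) (iota : {rmorphism Fq -> K})
  (hK : forall a : K, algebraicOver iota a)
  (m r : nat) (hm : (2 <= m)%N) (hr : (2 <= r)%N) (hpm : ~~ (p %| m)%N)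
  (alpha : 'I_r -> K) (halpha : injective alpha)
  (lambda : 'I_r -> nat) (hlambda : forall i, (1 <= lambda i < m)%N)
  (hcop : coprime m (lambda0 lambda))
  (* L = K(x, y) is the function field of the curve *)
  (L : fieldExtType (ratfun K)) (y : L)
  (hy : y ^+ m = \prod_(i < r) (ff_x L - ff_const L (alpha i)) ^+ lambda i)
  (hL : <<1; y>>%VS = fullv)
  (Qinf : place L) (hQ : ord_at Qinf (ff_x L) < 0) :
  let eta := kummer_eta m lambda in
  let epsilon := kummer_epsilon m lambda in
  let lambda0 := lambda0 lambda in
  exists F mu : nat,
  [/\ is_frobenius_number (weierstrass_semigroup Qinf) F,
      is_multiplicity (weierstrass_semigroup Qinf) mu
    & [/\ (* (i) *)
      F%:Z = epsilon r.-1 <->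
        (forall s : nat, (r <= s <= lambda0.-1)%N ->
           (eta s + eta (r + lambda0 - 1 - s) = m - 1)%N ->
           (eta s < s * m %/ lambda0)%N),
      (* (ii); the default epsilon r.-1 is the value at k = r.-1, in the range *)
      F%:Z = \big[Num.max/epsilon r.-1]_(r.-1 <= k < lambda0
                | eta k == ((k + 1 - r) * m %/ lambda0)%N) epsilon k,
      (* (iii) *)
      (forall j, coprime m (lambda j)) ->
        mu%:Z = Num.min m%:Z ((m * r.-1)%N%:Z - F%:Z)
    & (* (iv); if r != lambda0 then r < lambda0, and the default is the value at r *)
      (forall j, (lambda j %| m)%N) ->
        mu%:Z =
          if r == lambda0 then Num.min m%:Z lambda0%:Z
          else Num.min m%:Z (Num.min lambda0%:Z
                 (epsilon r.-1 -
                  \big[Num.max/epsilon r]_(r <= k < lambda0) epsilon k))]].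
Proof.
move=> eta epsilon l0.
have p_char : p \in [pchar K].
  by apply: (rmorph_pchar iota); apply: card_finPcharP hq hp.
have m_neq0 : m%:R != 0 :> K by rewrite -(dvdn_pcharf p_char).
set H := weierstrass_semigroup Qinf.
have H_mem j a : H (m * a + apery m lambda j)%N.
  exact: (semigroup_mem hm m_neq0 hcop hy hL hQ).
have H_sub s : H s -> exists j a, (j < m)%N /\ s = (m * a + apery m lambda j)%N.
  exact: (semigroup_sub hm m_neq0 halpha hcop hy hL hQ).
have [mu muP] := multiplicity_ex hm H_mem.
exists (\max_(j < m) apery m lambda j - m)%N, mu; split=> //.
  exact: frobeniusP.
split.
- exact: frobenius_eps_small.
- exact: frobenius_max.
- by move=> co_lambda; apply: multiplicity_coprime muP co_lambda.
- by move=> dvd_lambda; apply: multiplicity_dvd muP dvd_lambda.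
Qed.
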